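(* Let $H$ be a $v$-noetherian monoid which is not a group, such that the conductor $(H : \widehat{H})\neq \emptyset$ and the class group $\mathcal C(\widehat H)$ of $\widehat H$ is a torsion group. Let $F=\widehat{H}^{\times}\times \mathcal F(P)$ be such that $\widehat{H}_{\mathrm{red}}\hookrightarrow \mathcal F(P)$ is a divisor theory, and let $E=\{p\in P\mid \text{there exists } n\in \mathbb N \text{ such that } p^n\in H\widehat{H}^{\times}\}$. 1. If $H\subset F$ is not simple, then $\rho_k(H)=\infty$ for all sufficiently large $k\in\mathbb N$, and $H$ satisfies the Structure Theorem for Unions. 2. If $H\subset F$ is simple and the set $\mathcal C_E(H,F)$ is finite, then $\rho(H)$ is rational and $H$ satisfies the Structure Theorem for Unions.
   Context: $\mathbb N$ is the set of positive integers, $\mathbb N_0=\mathbb N\cup\{0\}$. Monoids. A monoid is a commutative cancellative semigroup with identity, written multiplicatively. For a monoid $H$: $H^\times$ is its group of invertible elements, $H_{\mathrm{red}}=H/H^\times$, $\mathsf q(H)$ its quotient group, and $\widehat H=\{x\in\mathsf q(H)\mid \text{there is } c\in H \text{ with } cx^n\in H \text{ for all } n\in\mathbb N\}$ its complete integral closure. For $X,Y\subset \mathsf q(H)$ put $(X:Y)=\{a\in\mathsf q(H)\mid aY\subset X\}$ and $X_v=(H:(H:X))$. A subset $X\subset H$ is a $v$-ideal if $X_v=X$. $H$ is $v$-noetherian (a Mori monoid) if it satisfies the ascending chain condition on $v$-ideals. If $H$ is $v$-noetherian with $(H:\widehat H)\neq\emptyset$, then $\widehat H$ is a Krull monoid (completely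 integrally closed and $v$-noetherian) and $H^\times=\widehat H^\times\cap H$. Divisor theory and class group. $\mathcal F(P)$ denotes the free abelian monoid with basis $P$. A monoid homomorphism $\varphi:D\to\mathcal F(P)$ is a divisor homomorphism if $\varphi(a)\mid\varphi(b)$ in $\mathcal F(P)$ implies $a\mid b$ in $D$; it is a divisor theory if moreover every $p\in P$ is the greatest common divisor of the image of some finite nonempty subset of $D$. For a Krull monoid $\widehat H$ one has $\widehat H\cong\widehat H^\times\times\widehat H_{\mathrm{red}}$; via such an isomorphism and a divisor theory $\widehat H_{\mathrm{red}}\hookrightarrow\mathcal F(P)$ we regard $H\subset\widehat H\subset F=\widehat H^\times\times\mathcal F(P)$, a factorial monoid with $F^\times=\widehat H^\times$. The class group is $\mathcal C(\widehat H)=\mathsf q(\mathcal F(P))/\mathsf q(\widehat H_{\mathrm{red}})$ (equivalently $\mathsf q(F)/\mathsf q(\widehat H)$). Class semigroups and simplicity. Each $a\in F$ is uniquely $a=\varepsilon\prod_{p\in P}p^{\mathsf v_p(a)}$ with $\varepsilon\in F^\times$, $\mathsf v_p(a)\in\mathbb N_0$, almost all zero; $\mathrm{supp}_P(a)=\{p\in P\mid\mathsf v_p(a)\ne 0\}$. Elements $x,y\in F$ are $(H,F)$-equivalent if $x^{-1}H\cap F=y^{-1}H\cap F$; this is a congruence relation on $F$, and $[x]_H^F$ denotes the class of $x$. For $E\subset F$, $\mathcal C_E(H,F)=\{[x]_H^F\mid x\in E\}$. A subset $E'\subset P$ is $H$-essential if $E'=\mathrm{supp}_P(x)$ for some $x\in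 H\setminus H^\times$. $H$ is simple in $F$ if every minimal (with respect to inclusion) $H$-essential subset of $P$ is a singleton. Lengths. An atom is an irreducible element (a non-unit that is not a product of two non-units). For $a\in H\setminus H^\times$, $\mathsf L(a)\subset\mathbb N$ is the set of all $k$ such that $a$ is a product of $k$ atoms; $\mathsf L(a)=\{0\}$ for $a\in H^\times$. $\mathcal L(H)=\{\mathsf L(a)\mid a\in H\}$. For $k\in\mathbb N$ and $H$ not a group, $\mathcal U_k(H)=\bigcup_{k\in L,\,L\in\mathcal L(H)}L$, $\rho_k(H)=\sup\mathcal U_k(H)$, and $\rho(H)=\sup\{\rho_k(H)/k\mid k\in\mathbb N\}$ is the elasticity. AAPs. A subset $L\subset\mathbb Z$ is an almost arithmetical progression (AAP) with difference $d\in\mathbb N$ and bound $M\in\mathbb N_0$ if $L=y+(L'\cup L^*\cup L'')\subset y+d\mathbb Z$, where $y\in\mathbb Z$, $L^*$ is a nonempty (finite or infinite) arithmetical progression with difference $d$ and $\min L^*=0$, $L'\subset[-M,-1]$, and $L''\subset\sup L^*+[1,M]$ (with $L''=\emptyset$ if $L^*$ is infinite). $H$ satisfies the Structure Theorem for Unions if there are $d\in\mathbb N$ and $M\in\mathbb N_0$ such that $\mathcal U_k(H)$ is an AAP with difference $d$ and bound $M$ for all sufficiently large $k\in\mathbb N$. *)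

(* Defs.v *)
From HB Require Import structures.
From mathcomp Require Import all_boot all_order ssralg ssrnum ssrint rat.
From mathcomp Require Import boolp classical_sets cardinality.
From mathcomp Require Import reals constructive_ereal ereal.
From mathcomp.finmap Require Import finmap multiset.

Set Implicit Arguments.
Unset Strict Implicit.
Unset Printing Implicit Defensive.

Local Open Scope quotient_scope.
Local Open Scope mset_scope.
Local Open Scope classical_set_scope.
Local Open Scope group_scope.

HB.mixin Record Monoid_isCommCancel M of Monoid M := {
  mulmC : commutative (@mul M);
  mulmI : right_injective (@mul M)
}.

#[short(type="ccMonoidType")]
HB.structure Definition CCMonoid := {M of Monoid M & Monoid_isCommCancel M}.

HB.instance Definition _ (M : ccMonoidType) :=
  SemiGroup.isCommutativeLaw.Build M ( *%g ) (@mulmC M).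

Notation "{ 'hom' M -> N }" := (UMagmaMorphism.type M%type N%type)
  (at level 0, M at level 98, N at level 99, format "{ 'hom'  M  ->  N }")
  : type_scope.

Section Pair.
Variables M N : ccMonoidType.

Fact pair_mulmC : commutative (@mul (M * N)%type).
Proof. by move=> x y; congr (_, _); apply: mulmC. Qed.

Fact pair_mulmI : right_injective (@mul (M * N)%type).
Proof. by move=> [x1 x2] [y1 y2] [z1 z2] [/mulmI -> /mulmI ->]. Qed.

HB.instance Definition _ :=
  Monoid_isCommCancel.Build (M * N)%type pair_mulmC pair_mulmI.
End Pair.

Section Submonoid.
Variables (M : ccMonoidType) (S : umagmaClosed M).

Definition submonoid : Type := {x : M | x \in S}.

HB.instance Definition _ := SubChoice.on submonoid.

Fact submonoid_closed : monoid_closed (fun x : M => x \in S).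
Proof. by split=> [|x y]; [exact: gpred1|exact: gpredM]. Qed.

HB.instance Definition _ :=
  SubChoice_isSubMonoid.Build M (fun x : M => x \in S) submonoid
    submonoid_closed.

Fact submonoid_mulmC : commutative (@mul submonoid).
Proof. by move=> x y; apply: val_inj; rewrite !valM mulmC. Qed.

Fact submonoid_mulmI : right_injective (@mul submonoid).
Proof.
by move=> x y z /(congr1 val); rewrite !valM => /mulmI /val_inj.
Qed.

HB.instance Definition _ :=
  Monoid_isCommCancel.Build submonoid submonoid_mulmC submonoid_mulmI.
End Submonoid.

(** The quotient [M/S] by a submonoid [S]; if [S] is a group, the class of [x]
    is the coset [xS]. *)
Section QuotientMonoid.
Variables (M : ccMonoidType) (S : umagmaClosed M).

Definition quo_rel : rel M := fun x y =>
  `[< exists s t, [/\ s \in S, t \in S & x * s = y * t] >].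

Fact quo_rel_refl : reflexive quo_rel.
Proof. by move=> x; apply/asboolP; exists 1, 1; split=> //; exact: gpred1. Qed.

Fact quo_rel_sym : symmetric quo_rel.
Proof.
by move=> x y; apply/asboolP/asboolP => -[s [t [Ss St e]]]; exists t, s.
Qed.

Fact quo_rel_trans : transitive quo_rel.
Proof.
move=> y x z /asboolP[s [t [Ss St e]]] /asboolP[s' [t' [Ss' St' e']]].
apply/asboolP; exists (s * s'), (t * t'); split; try exact: gpredM.
by rewrite mulgA e -mulgA [t * s']mulmC mulgA e' -mulgA [t' * t]mulmC.
Qed.

Canonical quo_equiv := EquivRel quo_rel quo_rel_refl quo_rel_sym quo_rel_trans.

Definition quo : Type := {eq_quot quo_rel}.
HB.instance Definition _ := Choice.on quo.
HB.instance Definition _ := EqQuotient.on quo.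

Definition quo_proj (x : M) : quo := \pi_quo x.
Definition quo_one : quo := quo_proj 1.
Definition quo_mul (a b : quo) : quo := quo_proj (repr a * repr b).

Lemma quo_projP x y :
  quo_proj x = quo_proj y <->
  exists s t, [/\ s \in S, t \in S & x * s = y * t].
Proof.
split; first by move/eqP; rewrite /quo_proj eqmodE => /asboolP.
by move=> h; apply/eqP; rewrite /quo_proj eqmodE; apply/asboolP.
Qed.

Lemma quo_surj (a : quo) : exists x, a = quo_proj x.
Proof. by exists (repr a); rewrite /quo_proj reprK. Qed.

Lemma quo_mulE x y : quo_mul (quo_proj x) (quo_proj y) = quo_proj (x * y).
Proof.
have hr z : exists s t, [/\ s \in S, t \in S & repr (quo_proj z) * s = z * t].
  by apply/quo_projP; rewrite /quo_proj reprK.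
have [s [t [Ss St e]]] := hr x; have [s' [t' [Ss' St' e']]] := hr y.
apply/quo_projP; exists (s * s'), (t * t'); split; try exact: gpredM.
have mulmACA (a b c d : M) : (a * b) * (c * d) = (a * c) * (b * d).
  by rewrite -!mulgA; congr (_ * _); rewrite !mulgA [b * c]mulmC.
by rewrite mulmACA e e' mulmACA.
Qed.

Fact quo_mulA : associative quo_mul.
Proof.
move=> a b c; have [x ->] := quo_surj a; have [y ->] := quo_surj b.
by have [z ->] := quo_surj c; rewrite !quo_mulE mulgA.
Qed.

Fact quo_mul1 : left_id quo_one quo_mul.
Proof. by move=> a; have [x ->] := quo_surj a; rewrite quo_mulE mul1g. Qed.

Fact quo_mulr1 : right_id quo_one quo_mul.
Proof. by move=> a; have [x ->] := quo_surj a; rewrite quo_mulE mulg1. Qed.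

HB.instance Definition _ := isMonoid.Build quo quo_mulA quo_mul1 quo_mulr1.

Fact quo_mulC : commutative (@mul quo).
Proof.
move=> a b; have [x ->] := quo_surj a; have [y ->] := quo_surj b.
by rewrite [LHS]quo_mulE [RHS]quo_mulE mulmC.
Qed.

Fact quo_mulI : right_injective (@mul quo).
Proof.
move=> a b c; have [x ->] := quo_surj a; have [y ->] := quo_surj b.
have [z ->] := quo_surj c; rewrite [X in X = _]quo_mulE [X in _ = X]quo_mulE.
move=> /quo_projP[s [t [Ss St e]]]; apply/quo_projP; exists s, t; split=> //.
by apply: (@mulmI _ x); rewrite !mulgA.
Qed.

HB.instance Definition _ := Monoid_isCommCancel.Build quo quo_mulC quo_mulI.

Fact quo_proj_morph : monoid_morphism quo_proj.
Proof. by split=> // x y; rewrite [RHS]quo_mulE. Qed.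

HB.instance Definition _ := isUMagmaMorphism.Build M quo quo_proj quo_proj_morph.
End QuotientMonoid.

Section Units.
Variable M : ccMonoidType.

Definition invertible (x : M) : Prop := exists y, x * y = 1.

Definition units : {pred M} := fun x => `[< invertible x >].

Fact units1 : 1 \in units.
Proof. by apply/asboolP; exists 1; rewrite mulg1. Qed.

Fact unitsM : mulg_closed units.
Proof.
move=> x y /asboolP[x' ex] /asboolP[y' ey]; apply/asboolP; exists (x' * y').
by rewrite mulgA (ACl (1*3*(2*4))) /= ex ey mulg1.
Qed.

HB.instance Definition _ := isMulClosed.Build M units unitsM.
HB.instance Definition _ := isMul1Closed.Build M units units1.

Definition unit_group : ccMonoidType := @submonoid M units.

(** [M_red], the monoid of cosets of the unit group. *)
Definition reduced : ccMonoidType := @quo M units.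
End Units.

Section QuotientGroup.
Variable M : ccMonoidType.

Definition diag : {pred (M * M)%type} := fun z => z.1 == z.2.

Fact diag1 : 1 \in diag. Proof. by rewrite unfold_in /diag /=. Qed.

Fact diagM : mulg_closed diag.
Proof.
by move=> [x x'] [y y']; rewrite !unfold_in /diag /= => /eqP-> /eqP->.
Qed.

HB.instance Definition _ := isMulClosed.Build (M * M)%type diag diagM.
HB.instance Definition _ := isMul1Closed.Build (M * M)%type diag diag1.

(** [qgrp M] is [q(M)], realized as the quotient of [M * M] by its diagonal; the
    class of [(a, b)] is the fraction a/b, see [fracP]. *)
Definition qgrp : Type := quo diag.
HB.instance Definition _ := CCMonoid.on qgrp.

Definition frac (a b : M) : qgrp := quo_proj diag (a, b).

Lemma fracP a b c d : frac a b = frac c d <-> a * d = c * b.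
Proof.
split.
  move=> /quo_projP[[s s'] [[t t'] []]]; rewrite !unfold_in /diag /=.
  move=> /eqP <- /eqP <- [e1 e2]; apply: (@mulmI _ (s * t)).
  by rewrite (AC (2*2) ((3*1)*(4*2))) /= e1 -e2 (AC (2*2) ((4*2)*(1*3))).
move=> e; apply/quo_projP; exists (d, d), (b, b).
by rewrite !unfold_in /diag /= !eqxx; split=> //; congr (_, _); rewrite ?e // mulmC.
Qed.

Lemma frac_surj (x : qgrp) : exists a b, x = frac a b.
Proof. by have [[a b] ->] := quo_surj x; exists a, b. Qed.

Definition qgrp_inv (x : qgrp) : qgrp := frac (repr x).2 (repr x).1.

Lemma qgrp_invE a b : qgrp_inv (frac a b) = frac b a.
Proof.
apply/fracP; have: frac (repr (frac a b)).1 (repr (frac a b)).2 = frac a b.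
  by rewrite /frac -surjective_pairing /quo_proj reprK.
by move/fracP => e; rewrite mulmC -e mulmC.
Qed.

Lemma frac_mulE a b c d : frac a b * frac c d = frac (a * c) (b * d).
Proof. by rewrite /frac -[RHS]/(quo_proj diag ((a, b) * (c, d))) gmulfM. Qed.

Lemma fracxx a : frac a a = 1.
Proof. by apply/fracP; rewrite mulg1 mul1g. Qed.

Fact qgrp_mulV : left_inverse 1 qgrp_inv *%g.
Proof.
move=> x; have [a [b ->]] := frac_surj x.
by rewrite qgrp_invE frac_mulE [b * a]mulmC fracxx.
Qed.

Fact qgrp_mulrV : right_inverse 1 qgrp_inv *%g.
Proof. by move=> x; rewrite mulmC qgrp_mulV. Qed.

HB.instance Definition _ := hasInv.Build qgrp qgrp_inv.
HB.instance Definition _ := Monoid_isGroup.Build qgrp qgrp_mulV qgrp_mulrV.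

Definition inq (a : M) : qgrp := frac a 1.

Fact inq_morph : monoid_morphism inq.
Proof. by split=> [|a b]; rewrite /inq ?fracxx // frac_mulE mulg1. Qed.

HB.instance Definition _ := isUMagmaMorphism.Build M qgrp inq inq_morph.

Lemma inq_inj : injective inq.
Proof. by move=> a b /fracP; rewrite !mulg1. Qed.

Lemma inq_divE a b : inq a / inq b = frac a b.
Proof. by rewrite [_^-1]qgrp_invE frac_mulE mulg1 mul1g. Qed.
End QuotientGroup.

Section Ideals.
Variable H : ccMonoidType.
Implicit Types X Y : set (qgrp H).

Definition carrier : set (qgrp H) := range (@inq H).

(** [(X : Y)] and [X_v = (H : (H : X))], taken in [q(H)]. *)
Definition colon X Y : set (qgrp H) := [set a | forall y, Y y -> X (a * y)].
Definition vclosure X : set (qgrp H) := colon carrier (colon carrier X).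
Definition v_ideal X : Prop := X `<=` carrier /\ vclosure X = X.

Definition v_noetherian : Prop :=
  forall I : nat -> set (qgrp H),
    (forall n, v_ideal (I n)) -> (forall n, I n `<=` I n.+1) ->
    exists N, forall n, (N <= n)%N -> I n = I N.

(** The complete integral closure of [H], as a subset of [q(H)]; [cic_monoid]
    below is the same object as a monoid in its own right. *)
Definition cic : {pred qgrp H} := fun x =>
  `[< exists c : H, forall n, (0 < n)%N -> carrier (inq c * x ^+ n) >].

Fact cic1 : 1 \in cic.
Proof. by apply/asboolP; exists 1 => n _; exists 1; rewrite // expg1n mulg1. Qed.

Fact cicM : mulg_closed cic.
Proof.
move=> x y /asboolP[c cx] /asboolP[d dy]; apply/asboolP; exists (c * d) => n n0.
have [h _ eh] := cx n n0; have [k _ ek] := dy n n0; exists (h * k) => //.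
rewrite !gmulfM /= eh ek expgMn; last exact: mulmC.
by rewrite (AC (2*2) ((1*3)*(2*4))).
Qed.

HB.instance Definition _ := isMulClosed.Build (qgrp H) cic cicM.
HB.instance Definition _ := isMul1Closed.Build (qgrp H) cic cic1.

Definition cic_monoid : ccMonoidType := submonoid cic.

Definition conductor : set (qgrp H) := colon carrier [set x | x \in cic].

Fact inq_cic (h : H) : inq h \in cic.
Proof.
by apply/asboolP; exists 1 => n _; exists (h ^+ n); rewrite // gmulfXn gmulf1 mul1g.
Qed.

Definition in_cic (h : H) : cic_monoid := exist _ (inq h) (inq_cic h).

Fact in_cic_morph : monoid_morphism in_cic.
Proof.
split=> [|h k]; apply: val_inj; first by rewrite val1 /= gmulf1.
by rewrite valM /= gmulfM.
Qed.

HB.instance Definition _ :=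
  isUMagmaMorphism.Build H cic_monoid in_cic in_cic_morph.
End Ideals.
Arguments carrier : clear implicits.
Arguments conductor : clear implicits.

(** The free abelian monoid [F(P)] is [{mset P}]; the exponent [v_p(a)] is the
    multiplicity [a p]. *)
Section FreeMonoid.
Variable P : choiceType.

Fact mset_mulI : right_injective (@msetD P).
Proof.
move=> a b c /msetP e; apply/msetP => p; move: (e p).
by rewrite !msetE2 => /addnI.
Qed.

Fact mset_mul1 : left_id mset0 (@msetD P).
Proof. exact: mset0D. Qed.

Fact mset_mulr1 : right_id mset0 (@msetD P).
Proof. by move=> a; rewrite msetDC mset0D. Qed.

Fact mset_mulA : associative (@msetD P).
Proof. by move=> a b c; apply/msetP => p; rewrite !msetE2 addnA. Qed.

HB.instance Definition _ := Choice.on {mset P}.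
HB.instance Definition _ :=
  isMonoid.Build {mset P} mset_mulA mset_mul1 mset_mulr1.
HB.instance Definition _ :=
  Monoid_isCommCancel.Build {mset P} (@msetDC P) mset_mulI.
End FreeMonoid.

Definition mdvd (M : ccMonoidType) (a b : M) : Prop := exists c, b = a * c.

Definition is_gcd (M : ccMonoidType) (X : set M) (g : M) : Prop :=
  (forall x, X x -> mdvd g x) /\
  (forall d, (forall x, X x -> mdvd d x) -> mdvd d g).

Section DivisorTheory.
Variables (D : ccMonoidType) (P : choiceType) (phi : {hom D -> {mset P}}).

Definition divisor_homomorphism : Prop :=
  forall a b : D, mdvd (phi a) (phi b) -> mdvd a b.

Definition divisor_theory : Prop :=
  divisor_homomorphism /\
  forall p : P, exists X : set D,
    [/\ finite_set X, X !=set0 & is_gcd (phi @` X) [mset p]].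

(** The image of [q(D)] in [q(F(P))]; [class_group] is the quotient group of
    [q(F(P))] by it. *)
Definition principal : {pred qgrp {mset P}} := fun x =>
  `[< exists a b : D, x = inq (phi a) / inq (phi b) >].

Fact principal1 : 1 \in principal.
Proof. by apply/asboolP; exists 1, 1; rewrite divgg. Qed.

Fact principalM : mulg_closed principal.
Proof.
move=> x y /asboolP[a [b ->]] /asboolP[c [d ->]]; apply/asboolP.
by exists (a * c), (b * d); rewrite !inq_divE frac_mulE !gmulfM.
Qed.

HB.instance Definition _ := isMulClosed.Build (qgrp {mset P}) principal principalM.
HB.instance Definition _ := isMul1Closed.Build (qgrp {mset P}) principal principal1.

Definition class_group : ccMonoidType := quo principal.
End DivisorTheory.

Definition torsion (G : ccMonoidType) : Prop :=
  forall g : G, exists2 n, (0 < n)%N & g ^+ n = 1.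

Section ClassSemigroup.
Variables (H F : ccMonoidType) (iota : {hom H -> F}).

(** [trace x] is the subset [x^-1 H `&` F] of [q(F)]. *)
Definition trace (x : F) : set (qgrp F) :=
  [set (inq x)^-1 * inq (iota h) | h in [set: H]] `&` range (@inq F).

Definition HF_class (x : F) : set F := [set y | trace y = trace x].

Definition class_set (E : set F) : set (set F) := HF_class @` E.
End ClassSemigroup.

Section Ambient.
Variables (H : ccMonoidType) (P : choiceType).
Let Hc := cic_monoid H.

(** [F = Hc^x * F(P)], where [Hc] is the complete integral closure of [H]. *)
Definition ambient : ccMonoidType := (unit_group Hc * {mset P})%type.

Variables (psi : {hom Hc -> (unit_group Hc * reduced Hc)})
          (phi : {hom reduced Hc -> {mset P}}).

(** [psi] is meant to be an isomorphism and [phi] a divisor theory; together they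
    identify [Hc], and hence [H], with a submonoid of [F]. *)
Definition cic_embed (x : Hc) : ambient := ((psi x).1, phi (psi x).2).

Fact cic_embed_morph : monoid_morphism cic_embed.
Proof. by split=> [|x y]; rewrite /cic_embed ?gmulf1 ?gmulfM /= ?gmulf1 ?gmulfM. Qed.

HB.instance Definition _ :=
  isUMagmaMorphism.Build Hc ambient cic_embed cic_embed_morph.

Definition embed (h : H) : ambient := cic_embed (in_cic h).

Fact embed_morph : monoid_morphism embed.
Proof. by split=> [|x y]; rewrite /embed ?gmulf1 ?gmulfM. Qed.

HB.instance Definition _ := isUMagmaMorphism.Build H ambient embed embed_morph.

Definition supp (x : ambient) : set P := [set p | x.2 p <> 0%N].

Definition of_prime (p : P) : ambient := (1, [mset p]).

Definition essential (A : set P) : Prop :=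
  exists2 h : H, ~ invertible h & A = supp (embed h).

Definition simple : Prop :=
  forall A : set P,
    essential A -> (forall B, essential B -> B `<=` A -> B = A) ->
    exists p, A = [set p].

(** [p^n \in H Hc^x] for some positive [n]. *)
Definition E_set : set P :=
  [set p | exists n, (0 < n)%N /\ exists (h : H) (u : Hc),
     invertible u /\ of_prime p ^+ n = embed h * cic_embed u].
End Ambient.

Section Lengths.
Variable H : ccMonoidType.

Definition atom (a : H) : Prop :=
  ~ invertible a /\
  forall b c : H, a = b * c -> invertible b \/ invertible c.

Definition lengths (a : H) : set nat :=
  [set k | (invertible a /\ k = 0%N) \/
           (~ invertible a /\
            exists s : seq H, [/\ size s = k, {in s, forall x, atom x} &
                                  a = \prod_(x <- s) x])].

Definition length_system : set (set nat) := range lengths.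

Definition unions (k : nat) : set nat :=
  \bigcup_(L in [set L | length_system L /\ L k]) L.

Variable R : realType.

Definition rho_k (k : nat) : \bar R :=
  ereal_sup [set (n%:R%:E : \bar R)%E | n in unions k].

Definition elasticity : \bar R :=
  ereal_sup [set (rho_k k * ((k%:R : R)^-1)%R%:E)%E | k in [set k | (0 < k)%N]].
End Lengths.

(** [{0, d, ..., m d}] for [l = Some m], and [{0, d, 2 d, ...}] for [l = None]:
    the progressions with difference [d] and minimum 0. *)
Definition progression (d : nat) (l : option nat) : set int :=
  [set Posz (d * i) | i in [set i : nat | if l is Some m then (i <= m)%N : Prop
                                         else True]].

Definition AAP (d M : nat) (L : set int) : Prop :=
  exists (y : int) (l : option nat) (L' L'' : set int),
    [/\ L = [set (y + x)%R | x in L' `|` progression d l `|` L''],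
        L `<=` [set (y + d%:Z * z)%R | z in [set: int]],
        L' `<=` [set x : int | (- M%:Z <= x <= -1)%R] &
        if l is Some m
        then L'' `<=` [set x : int | (Posz (d * m) + 1 <= x <= Posz (d * m) + M%:Z)%R]
        else L'' = set0].

Definition structure_theorem_for_unions (H : ccMonoidType) : Prop :=
  exists d M : nat, (0 < d)%N /\
    exists k0, forall k, (0 < k)%N -> (k0 <= k)%N ->
      AAP d M (Posz @` unions H k).

(* Main.v *)
Require Import Defs.
From HB Require Import structures.
From mathcomp Require Import all_boot all_order ssralg ssrnum ssrint rat.
From mathcomp Require Import boolp classical_sets cardinality.
From mathcomp Require Import reals constructive_ereal ereal.
From mathcomp.finmap Require Import finmap multiset.
From mathcomp Require Import archimedean zify lra.

Set Implicit Arguments.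
Unset Strict Implicit.
Unset Printing Implicit Defensive.

Local Open Scope mset_scope.
Local Open Scope classical_set_scope.

(** Write [v] for the divisor map from [Hc], the complete integral closure of [H],
    to [F(P)], and choose [f] in [H] with [f Hc] contained in [H].

    Non-simple case. Let [supp h = {p_1, ..., p_m}] (primes repeated according to
    multiplicity) be a minimal essential set that is not a singleton. As the class
    group is torsion, some [a_i] in [Hc] has [v a_i = n p_i], and the product of
    the elements [f a_i^N] equals [f^m h^(n N)] up to a unit. No [{p_i}] is
    essential, so every atom dividing [f a_i^N] uses up a prime of [f] and the left
    side has a factorization of bounded length, while the right side has
    factorizations whose lengths grow linearly in [N].

    Simple case. Replacing a prime of [E] by another prime of the same class maps
    atoms to atoms, so only finitely many primes of [E] matter, and as [H] is
    v-noetherian their exponents in atoms are bounded. Hence atoms have finitely many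
    types, and by Dickson's lemma the ratio of the numbers of atoms on the two sides
    of an equation between types attains a maximum [l0 / k0]. An equation between
    types lifts to [H] after raising it to a power and multiplying both sides by
    elements [f a] with [v a] outside [E]; these have factorizations of bounded
    length, since every atom involves a prime of [E].

    The Structure Theorem then only uses that the sets [U_k] are subadditive and
    symmetric: their differences form a subgroup [d Z] of the integers, so suitable
    sets contain arbitrarily long progressions with difference [d], which fill the gaps
    of the families just constructed. *)

(** * Recognizing almost arithmetical progressions *)

Lemma eq_modn_int (d l lo : nat) : l = lo %[mod d] ->
  exists z : int, Posz l = (Posz lo + d%:Z * z)%R.
Proof.
move=> e; exists (Posz (l %/ d) - Posz (lo %/ d))%R.
have e1 := divn_eq l d; have e2 := divn_eq lo d; rewrite e in e1.
have {}e1 : Posz l = (Posz (l %/ d) * Posz d + Posz (lo %% d))%R.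
  by rewrite [in LHS]e1; lia.
have {}e2 : Posz lo = (Posz (lo %/ d) * Posz d + Posz (lo %% d))%R.
  by rewrite [in LHS]e2; lia.
by nia.
Qed.

Lemma AAP_inf (d M lo : nat) (U : set nat) :
  (forall l, U l -> l = lo %[mod d]) -> (forall i, U (lo + d * i)%N) ->
  (forall l, U l -> (lo <= l + M)%N) -> AAP d M (Posz @` U).
Proof.
move=> Umod Ulo UM.
have dvd l : U l -> exists z : int, Posz l = (Posz lo + d%:Z * z)%R.
  by move=> /Umod; exact: eq_modn_int.
exists (Posz lo), None, [set x : int | (x < 0)%R /\ (Posz @` U) (Posz lo + x)%R], set0.
split=> //.
- apply/seteqP; split=> x /=.
    move=> [l Ul <-]; exists (Posz l - Posz lo)%R; last by lia.
    left; have [z ez] := dvd _ Ul.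
    have [lt|ge] := boolP (l < lo)%N.
      by left; split; [lia|exists l => //; lia].
    right; exists (`|z|)%N => //.
    case: (posnP d) => [d0|dp]; first by rewrite ez d0; lia.
    have z0 : (0 <= z)%R by nia.
    by rewrite ez PoszM gez0_abs //; lia.
  move=> [y [[[_ [l Ul e]]|[i _ <-]]|//] <-]; first by exists l.
  by exists (lo + d * i)%N => //; exact: Ulo.
- by move=> _ [l Ul <-]; have [z ez] := dvd _ Ul; exists z.
- by move=> x /= [x0 [l Ul e]]; have := UM _ Ul; lia.
Qed.

Lemma AAP_fin (d M lo m : nat) (U : set nat) :
  (forall l, U l -> l = lo %[mod d]) ->
  (forall i, (i <= m)%N -> U (lo + d * i)%N) ->
  (forall l, U l -> (lo <= l + M)%N /\ (l <= lo + d * m + M)%N) ->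
  AAP d M (Posz @` U).
Proof.
move=> Umod Ulo UM.
have dvd l : U l -> exists z : int, Posz l = (Posz lo + d%:Z * z)%R.
  by move=> /Umod; exact: eq_modn_int.
exists (Posz lo), (Some m), [set x : int | (x < 0)%R /\ (Posz @` U) (Posz lo + x)%R],
  [set x : int | (Posz (d * m) < x)%R /\ (Posz @` U) (Posz lo + x)%R].
split=> //.
- apply/seteqP; split=> x /=.
    move=> [l Ul <-]; exists (Posz l - Posz lo)%R; last by lia.
    have [z ez] := dvd _ Ul.
    have [lt|ge] := boolP (l < lo)%N.
      by left; left; split; [lia|exists l => //; lia].
    have [lt|ge'] := boolP (lo + d * m < l)%N.
      by right; split; [lia|exists l => //; lia].
    (* For [d = 0] the quotient [z] is arbitrary, so index [0] is taken to stay below [m]. *)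
    left; right; exists (if d == 0%N then 0%N else `|z|%N) => /=; last first.
      case: eqP => [d0|dp]; first by rewrite ez d0; lia.
      have z0 : (0 <= z)%R by nia.
      by rewrite ez PoszM gez0_abs //; lia.
    by case: eqP => [//|dp]; nia.
  move=> [y [[[_ [l Ul e]]|[i im <-]]|[_ [l Ul e]]] <-]; [by exists l| |by exists l].
  by exists (lo + d * i)%N => //; exact: Ulo.
- by move=> _ [l Ul <-]; have [z ez] := dvd _ Ul; exists z.
- by move=> x /= [x0 [l Ul e]]; have := UM _ Ul; lia.
- by move=> x /= [x0 [l Ul e]]; have := UM _ Ul; lia.
Qed.

(** Used with [x = N k0] and [y = N (l0 - k0)]: once a pair close to [(N k0, N l0)] is split off,
    the remainders [z + s] and [z + s + t] differ by a bounded [t], which a long progression can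
    cover. *)
Lemma window_arith (x y e c c' C k l z : nat) :
  (c <= C)%N -> (c' <= C)%N -> (k <= l)%N -> (y + c' <= l - k + c)%N ->
  (l - k - C < y + e)%N -> (x + C + z <= k)%N ->
  exists s t, [/\ k = x + c + (z + s), l = x + y + c' + (z + s + t) &
                  t <= e + C + C]%N.
Proof.
move=> cC cC' kl h1 h2 h3.
by exists (k - (x + c + z))%N, (l - (x + y + c') - (k - (x + c)))%N; split; lia.
Qed.

(** * Symmetric subadditive families of sets of naturals *)

Section SubadditiveFamily.
Variable U : nat -> set nat.
Hypothesis Urefl : forall k, U k k.
Hypothesis Usym : forall k l, U k l -> U l k.
Hypothesis UD : forall k l k' l', U k l -> U k' l' -> U (k + k') (l + l').

Let STU := exists d M : nat, (0 < d)%N /\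
  exists k0, forall k, (0 < k)%N -> (k0 <= k)%N -> AAP d M (Posz @` U k).

Lemma unionM n k l : U k l -> U (n * k) (n * l).
Proof.
move=> Ukl; elim: n => [|n IH]; first by rewrite !mul0n; exact: Urefl.
by rewrite !mulSn; exact: UD.
Qed.

Lemma unionDr n k l : U k l -> U (k + n) (l + n).
Proof. by move=> Ukl; exact: UD. Qed.

(** By symmetry and additivity the differences [D] are closed under subtraction and multiples, so
    division with remainder shows that the least positive one divides them all. *)
Lemma difference_gcd :
  (forall k l, U k l -> k = l) \/
  exists d k, [/\ (0 < d)%N, U k (k + d) & forall k l, U k l -> l = k %[mod d]].
Proof.
pose D e := exists k, U k (k + e).
have DB e e' : D (e + e') -> D e' -> D e.
  move=> [k Uk] [k' Uk']; exists (k + (k' + e'))%N.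
  have := UD Uk (Usym Uk'); congr (U _ _); lia.
have DM n e : D e -> D (n * e)%N.
  by move=> [k /(unionM n)]; rewrite mulnDr => h; exists (n * k)%N.
have UD' k l : U k l -> (k <= l)%N -> D (l - k)%N.
  by move=> Ukl kl; exists k; rewrite subnKC.
case: (pselect (exists e, `[< (0 < e)%N /\ D e >])) => [ex|nex]; last first.
  left=> k l Ukl; apply/eqP/negPn/negP => kl; apply: nex.
  have [lt|ge] := leqP k l.
    exists (l - k)%N; apply/asboolP; split; last exact: UD'.
    by lia.
  exists (k - l)%N; apply/asboolP; split; first by lia.
  by apply: UD'; [exact: Usym|exact: ltnW].
right; have [d /asboolP[d0 [k Uk]] dmin] := ex_minnP ex; exists d, k; split=> //.
have dD e : D e -> (d %| e)%N.
  move=> De; rewrite /dvdn; case: (posnP (e %% d)) => [//|r0].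
  have : (d <= e %% d)%N.
    apply: dmin; apply/asboolP; split=> //.
    apply: (DB _ (e %/ d * d)%N); first by rewrite addnC -divn_eq.
    by apply: DM; exists k.
  by rewrite leqNgt ltn_mod d0.
have cong a b : U a b -> (a <= b)%N -> b = a %[mod d].
  by move=> Uab ab; apply/eqP; rewrite eqn_mod_dvd //; apply: dD; exact: UD'.
move=> a b Uab; case: (leqP a b) => [|/ltnW] ab; first exact: cong.
by apply/esym/cong => //; exact: Usym.
Qed.

Lemma long_progression d k J j : U k (k + d) -> (j <= J)%N ->
  U (J * k) (J * k + j * d).
Proof.
move=> Uk jJ; have := UD (unionM j Uk) (unionM (J - j) (Urefl k)).
by rewrite -mulnDl mulnDr addnAC -mulnDl subnKC.
Qed.

Lemma eq_mod_ge d a b : (0 < d)%N -> b = a %[mod d] -> (a <= b)%N ->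
  exists i, b = (a + i * d)%N.
Proof.
move=> d0 e ab; exists ((b - a) %/ d)%N; rewrite divnK ?subnKC //.
by rewrite -eqn_mod_dvd // e.
Qed.

Lemma union_half_factorial : (forall k l, U k l -> k = l) -> STU.
Proof.
move=> h; exists 1%N, 0%N; split=> //; exists 0%N => k _ _.
apply: (@AAP_fin _ _ k 0) => [l _|i|l /h ->]; first by rewrite !modn1.
  by rewrite leqn0 => /eqP ->; rewrite addn0; exact: Urefl.
by rewrite muln0 !addn0.
Qed.

Section Unbounded.
Variables B al G : nat.
Hypothesis al0 : (0 < al)%N.
Hypothesis UB : forall N, exists2 c, (c <= G)%N & U B (N * al + c).

Lemma union_unbounded k x : (B <= k)%N -> exists2 l, (x <= l)%N & U k l.
Proof.
move=> Bk; have [c _ Uc] := UB x; exists (x * al + c + (k - B))%N; first by nia.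
by have := unionDr (k - B) Uc; rewrite subnKC.
Qed.

(** By [tail], [U k1] contains all large [l] of the right residue class. Adding the mirrored pair
    [U T k1] to [U k1 (T + i d)] yields [U K (K + i d)] for all [i], which translation and symmetry
    extend to all pairs of congruent numbers from [K] on. *)
Lemma structure_unbounded : STU.
Proof.
have [/union_half_factorial //|[d [k [d0 Uk Umod]]]] := difference_gcd.
have mod_ge k' x : exists2 l, (x <= l)%N & l = k' %[mod d].
  by exists (k' + x * d)%N; [nia|rewrite addnC modnMDl].
(* With the [N] chosen below, [l] exceeds [N al + c + J k] by at most [al + G], which is within
   reach of [J] steps of size [d]. *)
pose J := (al + G)%N; pose k1 := (B + J * k)%N.
have tail l : (k1 + J <= l)%N -> l = k1 %[mod d] -> U k1 l.
  move=> kl le; pose N := ((l - J * k - G) %/ al)%N.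
  have [c cG Uc] := UB N.
  have := leq_trunc_div (l - J * k - G) al; rewrite -/N => N1.
  have := ltn_ceil (l - J * k - G) al0; rewrite -/N => N2.
  have /(eq_mod_ge d0) : l = (N * al + c + J * k)%N %[mod d].
    by rewrite le /k1 -modnDml -(Umod _ _ Uc) modnDml.
  case=> [|j ej]; first by rewrite /k1 /J in kl *; nia.
  have jJ : (j <= J)%N by rewrite /k1 /J in kl *; nia.
  rewrite ej -addnA; apply: UD => //; exact: long_progression.
have [T T1 Tm] := mod_ge k1 (k1 + J)%N.
pose K := (T + k1)%N.
have main k' l : (K <= k')%N -> (k' <= l)%N -> l = k' %[mod d] -> U k' l.
  move=> Kk kl le.
  have [i ei] := eq_mod_ge d0 le kl.
  have h : U T k1 by apply/Usym/tail.
  have h2 : U k1 (T + i * d)%N.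
    by apply: tail; [lia|rewrite addnC modnMDl].
  by have := unionDr (k' - K) (UD h h2); congr (U _ _); rewrite /K; lia.
exists d, (K + d)%N; split=> //; exists K => k' _ Kk.
have lom : (K + (k' - K) %% d = k' %[mod d])%N by rewrite modnDmr subnKC.
have lod : ((k' - K) %% d < d)%N by rewrite ltn_mod.
apply: (@AAP_inf _ _ (K + (k' - K) %% d)).
- by move=> l /Umod ->; rewrite lom.
- move=> i; set l := (_ + d * i)%N.
  have le : l = k' %[mod d] by rewrite /l -modnDmr modnMr addn0.
  case: (leqP k' l) => [|/ltnW] kl; first exact: main.
  by apply/Usym/main => //; rewrite /l; lia.
- by move=> l _; lia.
Qed.
End Unbounded.

Section Bounded.
Variables k0 l0 C : nat.
Hypothesis k0_gt0 : (0 < k0)%N.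
Hypothesis kl0 : (k0 <= l0)%N.
Hypothesis UC : forall N, exists c c',
  [/\ (c <= C)%N, (c' <= C)%N & U (N * k0 + c) (N * l0 + c')].
Hypothesis Ule : forall k l, U k l -> (l * k0 <= k * l0)%N.

(* To reach [l] from [k], split off the multiple of the extremal pair [(k0, l0)]
   that accounts for most of [l - k]; what is left of [k] is large if [l k0] is
   far enough below [k l0], and a long progression covers what is left of [l]. *)
Lemma structure_bounded : STU.
Proof.
have [l0k0|lt] := eqVneq l0 k0.
  apply: union_half_factorial => k l Ukl; apply/eqP; rewrite eqn_leq.
  have := Ule Ukl; have := Ule (Usym Ukl).
  by rewrite l0k0 !leq_pmul2r // => -> ->.
have {}lt : (k0 < l0)%N by rewrite ltn_neqAle eq_sym lt.
have [/union_half_factorial //|[d [k [d0 Uk Umod]]]] := difference_gcd.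
pose e := (l0 - k0)%N; have e0 : (0 < e)%N by rewrite subn_gt0.
have l0E : l0 = (k0 + e)%N by rewrite subnKC // ltnW.
(* [J] is the bound on [t] in [window_arith]; [M1] is chosen so that [N k0 + C + J k <= k'] follows
   after multiplication by [e]. *)
pose J := (e + C + C)%N; pose M1 := ((C + J * k) * e)%N.
have main k' l : (k' <= l)%N -> l = k' %[mod d] ->
    (l * k0 + M1 <= k' * l0)%N -> U k' l.
  move=> kl lk lM; pose N := ((l - k' - C) %/ e)%N.
  have N1 := leq_trunc_div (l - k' - C) e; rewrite -/N in N1.
  have N2 := ltn_ceil (l - k' - C) e0; rewrite -/N in N2.
  have [c [c' [cC cC' Uc N3]]] : exists c c', [/\ (c <= C)%N, (c' <= C)%N,
      U (N * k0 + c) (N * l0 + c') & (N * e + c' <= l - k' + c)%N].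
    (* For [N = 0] the subtraction of [C] may have been truncated, so [(0, 0)] replaces the given
       pair. *)
    have [N0|Np] := posnP N.
      by exists 0%N, 0%N; rewrite N0; split=> //; exact: Urefl.
    have [c [c' [cC cC' Uc]]] := UC N; exists c, c'; split=> //.
    have : (e <= N * e)%N by rewrite leq_pmull.
    by lia.
  have N4 : (N * k0 + C + J * k <= k')%N.
    rewrite -(leq_pmul2r e0).
    have : (N * e * k0 <= (l - k') * k0)%N.
      by rewrite leq_mul2r; apply/orP; right; lia.
    move: lM; rewrite l0E /M1 -{1}(subnKC kl); nia.
  rewrite mulSn addnC in N2.
  have [s [t [ek el tJ]]] := window_arith cC cC' kl N3 N2 N4.
  rewrite -mulnDr -l0E in el.
  have /(eq_mod_ge d0) : (J * k + s + t = J * k + s %[mod d])%N.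
    apply/eqP; rewrite -(eqn_modDl (N * l0 + c')) -el lk ek.
    by rewrite -modnDml -(Umod _ _ Uc) modnDml.
  case=> [|j ej]; first exact: leq_addr.
  have jJ : (j <= J)%N.
    apply: leq_trans (leq_pmulr j d0) _.
    by rewrite -(leq_add2l (J * k + s)) -ej leq_add2l.
  have := UD Uc (unionDr s (long_progression Uk jJ)).
  by rewrite [(J * k + j * d + s)%N]addnAC -ej -ek -el.
exists d, (M1 + l0 + d)%N; split=> //; exists (M1 + l0)%N => k' _ Kk.
(* Between [X] and [Y], [main] or its mirror image applies; [Ule] keeps all of [U k'] within a
   constant of this interval. *)
pose X := ((k' * k0 + M1) %/ l0).+1; pose Y := ((k' * l0 - M1) %/ k0)%N.
have l0_gt0 : (0 < l0)%N by lia.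
have X1 := leq_trunc_div (k' * k0 + M1) l0.
have X2 := ltn_ceil (k' * k0 + M1) l0_gt0; rewrite -/X in X2.
have X3 : (X * l0 <= k' * k0 + M1 + l0)%N by rewrite /X mulSn; lia.
have Y1 := leq_trunc_div (k' * l0 - M1) k0; rewrite -/Y in Y1.
have Y2 := ltn_ceil (k' * l0 - M1) k0_gt0; rewrite -/Y in Y2.
have Xk : (X <= k')%N.
  rewrite -(leq_pmul2r l0_gt0); apply: leq_trans X3 _.
  rewrite [in leqRHS]l0E mulnDr -addnA leq_add2l.
  by apply: leq_trans Kk _; exact: leq_pmulr.
have Mk : (M1 <= k' * l0)%N.
  by apply: leq_trans (leq_pmulr _ l0_gt0); apply: leq_trans Kk; exact: leq_addr.
pose lo := (X + (k' - X) %% d)%N.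
have lom : lo = k' %[mod d] by rewrite modnDmr subnKC.
have lod : ((k' - X) %% d < d)%N by rewrite ltn_mod.
have lok : (lo <= k')%N by rewrite -[in leqRHS](subnKC Xk) leq_add2l leq_mod.
have m1 := leq_trunc_div (Y - lo) d.
have m2 := ltn_ceil (Y - lo) d0.
apply: (@AAP_fin _ _ lo ((Y - lo) %/ d)).
- by move=> l /Umod ->; rewrite lom.
- move=> i im; set l := (_ + d * i)%N.
  have le : l = k' %[mod d] by rewrite /l -modnDmr modnMr addn0.
  case: (leqP l k') => kl.
    apply/Usym/main => //; apply: leq_trans (ltnW X2) _.
    by rewrite leq_mul2r /l /lo -addnA leq_addr orbT.
  apply: main => //; first exact: ltnW.
  have : (l <= Y)%N.
    have id : (d * i <= Y - lo)%N.
      by rewrite mulnC; apply: leq_trans m1; rewrite leq_mul2r im orbT.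
    move: id lok kl; rewrite /l; move: (d * i)%N (lo) (Y); clear; lia.
  rewrite -(leq_pmul2r k0_gt0) => h.
  by rewrite -(subnK Mk) leq_add2r; exact: leq_trans Y1.
- move=> l Ul; split.
    have h : (X <= l + M1 + l0)%N.
      rewrite -(leq_pmul2r l0_gt0) -addnA mulnDl; apply: leq_trans X3 _.
      rewrite -addnA; apply: leq_add; first exact: Ule (Usym Ul).
      exact: leq_pmulr.
    by apply: leq_trans (leq_add h (ltnW lod)) _; rewrite !addnA.
  have h : (l <= Y + M1 + k0)%N.
    rewrite -(leq_pmul2r k0_gt0); apply: leq_trans (Ule Ul) _.
    rewrite -(subnK Mk) !mulnDl addnAC; apply: leq_add; last exact: leq_pmulr.
    apply: leq_trans (ltnW Y2) _; rewrite mulSn addnC leq_add2l.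
    exact: leq_pmulr.
  have Yl : (Y <= lo + d * ((Y - lo) %/ d) + d)%N.
    by rewrite -addnA -leq_subLR mulnC addnC -mulSn ltnW.
  apply: leq_trans h _; rewrite -addnA.
  apply: leq_trans (leq_add Yl (leq_add (leqnn M1) kl0)) _.
  by rewrite -[leqLHS]addnA [(d + _)%N]addnC.
Qed.
End Bounded.
End SubadditiveFamily.

(** * Monotone subsequences, Dickson's lemma and extremal ratios *)

(** Choose successively indices at which [f] attains its minimum over the remaining tail. *)
Lemma increasing_subsequence (f : nat -> nat) :
  exists2 g : nat -> nat, {homo g : i j / (i < j)%N} &
    {homo f \o g : i j / (i <= j)%N}.
Proof.
have tail_min m : exists n, (m <= n)%N /\ forall n', (m <= n')%N -> (f n <= f n')%N.
  have ex : exists y, `[< exists2 n, (m <= n)%N & f n = y >].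
    by exists (f m); apply/asboolP; exists m.
  have [y /asboolP[n mn <-] ymin] := ex_minnP ex; exists n; split=> // n' mn'.
  by apply: ymin; apply/asboolP; exists n'.
have [step stepP] := choice tail_min.
pose g := fix g k := if k is k'.+1 then step (g k').+1 else step 0%N.
have gS k : (g k < g k.+1)%N by have [] := stepP (g k).+1.
have gincr : {homo g : i j / (i < j)%N} by apply: homo_ltn => // ? ? ?; apply: ltn_trans.
exists g => //; have fg k n : (g k <= n)%N -> (f (g k) <= f n)%N.
  case: k => [|k] gn; first by apply: (stepP 0%N).2.
  by apply: (stepP (g k).+1).2; apply: leq_trans gn; exact: gS.
move=> i j; rewrite leq_eqVlt => /orP[/eqP -> //|/gincr gij].
by apply: fg; exact: ltnW.
Qed.

(** Monotone subsequences are extracted for one coordinate after the other; the first two surviving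
    indices do. *)
Lemma dickson (I : finType) (f : nat -> I -> nat) :
  exists i j, (i < j)%N /\ forall x, (f i x <= f j x)%N.
Proof.
suff [g gincr fg] : exists2 g : nat -> nat, {homo g : i j / (i < j)%N} &
    forall x, x \in enum I -> {homo (fun i => f (g i) x) : i j / (i <= j)%N}.
  exists (g 0%N), (g 1%N); split; first exact: gincr.
  by move=> x; apply: fg => //; rewrite mem_enum.
elim: (enum I) => [|y s [g gincr fg]]; first by exists id.
have [h hincr fh] := increasing_subsequence (fun i => f (g i) y).
have hle : {homo h : i j / (i <= j)%N}.
  by move=> i j; rewrite leq_eqVlt => /orP[/eqP -> //|/hincr /ltnW].
exists (g \o h) => [i j ij|x]; first by apply/gincr/hincr.
by rewrite inE => /orP[/eqP -> //|xs] i j /hle; exact: fg.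
Qed.

(* If the maximum of [K / L] were not attained, there would be a sequence in which
   each element has the least [L] among those of larger ratio than its predecessor.
   If [s_i <= s_j] with [i < j], then [s_j - s_i] still has larger ratio than
   [s_(j-1)], but smaller [L] than [s_j]. *)
Lemma ratio_attained (I : finType) (S : set (I -> nat)) (K L : (I -> nat) -> nat) :
  (forall s t, S s -> S t -> (forall x, s x <= t x)%N ->
     S (fun x => t x - s x)%N) ->
  (forall s t, (forall x, s x <= t x)%N -> K s + K (fun x => t x - s x)%N = K t)%N ->
  (forall s t, (forall x, s x <= t x)%N -> L s + L (fun x => t x - s x)%N = L t)%N ->
  (forall s, S s -> L s = 0%N -> K s = 0%N) ->
  (exists2 s, S s & (0 < L s)%N) ->
  exists s, [/\ S s, (0 < L s)%N & forall t, S t -> (K t * L s <= K s * L t)%N].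
Proof.
move=> SB KB LB S0 [s0 Ss0 Ls0]; apply: contrapT => nmax.
pose better s t := S t /\ (K s * L t < K t * L s)%N.
have next s : exists t, S s /\ (0 < L s)%N ->
    better s t /\ forall u, better s u -> (L t <= L u)%N.
  case: (pselect (S s /\ (0 < L s)%N)) => [[Ss Ls]|]; last by exists s.
  have ex : exists y, `[< exists2 t, better s t & L t = y >].
    apply: contrapT => nex; apply: nmax; exists s; split=> // t St.
    rewrite leqNgt; apply/negP => lt; apply: nex; exists (L t).
    by apply/asboolP; exists t.
  have [y /asboolP[t st <-] ymin] := ex_minnP ex; exists t => _; split=> // u su.
  by apply: ymin; apply/asboolP; exists u.
have [nx nxP] := choice next.
pose g := fix g k := if k is k'.+1 then nx (g k') else s0.
have gP k : S (g k) /\ (0 < L (g k))%N.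
  elim: k => [|k /[dup] IH /nxP[[Sg lt] _]] //; split=> //=.
  rewrite lt0n; apply/eqP => L0; move: lt; rewrite L0 (S0 _ Sg L0); lia.
have gS k : (K (g k) * L (g k.+1) < K (g k.+1) * L (g k))%N.
  by have [[]] := nxP _ (gP k).
have gle i j : (i <= j)%N -> (K (g i) * L (g j) <= K (g j) * L (g i))%N.
  elim: j => [|j IH]; first by rewrite leqn0 => /eqP ->.
  rewrite leq_eqVlt => /orP[/eqP -> //|]; rewrite ltnS => /IH ij.
  rewrite -(leq_pmul2r (gP j).2); have := gS j; have := (gP i).2.
  move: (K (g i)) (L (g i)) (K (g j)) (L (g j)) (K (g j.+1)) (L (g j.+1)) ij.
  by nia.
have [i [[|j] [ij le]]] := dickson g; first by [].
rewrite ltnS in ij.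
have /(nxP _ (gP j)).2 : better (g j) (fun x => g j.+1 x - g i x)%N.
  split; first by apply: SB => //; [exact: (gP i).1|exact: (gP j.+1).1].
  have := gle _ _ ij; have := gS j; rewrite -(KB _ _ le) -(LB _ _ le).
  by rewrite !mulnDl !mulnDr; lia.
have -> : nx (g j) = g j.+1 by [].
by rewrite -(LB _ _ le); have := (gP i).2; lia.
Qed.

(** * Elasticity computed from an extremal family *)

Section Elasticity.
Import Order.TTheory GRing.Theory Num.Theory.
Variables (R : realType) (H : ccMonoidType).

Lemma rho_infty k :
  (forall x, exists2 l, (x <= l)%N & unions H k l) -> rho_k H R k = +oo%E.
Proof.
move=> Uoo; apply/eqyP => A A0.
have [n An] : exists n : nat, (A <= n%:R)%R.
  by exists (Num.truncn A).+1; apply: ltW; exact: truncnS_gt.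
have [l nl Ul] := Uoo n; apply: le_trans (_ : l%:R%:E <= _)%E.
  by rewrite lee_fin (le_trans An) // ler_nat.
by apply: ereal_sup_ubound; exists l.
Qed.

(** Every [l / k] is at most [l0 / k0], and [(N l0 + c') / (N k0 + c)] tends to this value: a real
    elasticity [r] below it would satisfy [N (l0 - r k0) <= r C] for all [N > 0]. *)
Lemma elasticity_eq k0 l0 C : (0 < k0)%N ->
  (forall N, exists c c', [/\ (c <= C)%N, (c' <= C)%N &
                              unions H (N * k0 + c) (N * l0 + c')]) ->
  (forall k l, unions H k l -> (l * k0 <= k * l0)%N) ->
  elasticity H R = (ratr (l0%:Q / k0%:Q)%R)%:E%E.
Proof.
move=> k0_gt0 UC Ule; rewrite rmorphM /= fmorphV /= -!pmulrn !ratr_nat.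
have k0R : (0 < k0%:R :> R)%R by rewrite ltr0n.
apply/eqP; rewrite eq_le; apply/andP; split.
  apply: ge_ereal_sup => _ [k /= k_gt0 <-].
  have kR : (0 < k%:R :> R)%R by rewrite ltr0n.
  rewrite lee_pdivrMr // -EFinM; apply: ge_ereal_sup => _ [l Ul <-].
  by rewrite lee_fin mulrAC ler_pdivlMr // -!natrM ler_nat mulnC (mulnC l0) mulnC Ule.
rewrite leNgt; apply/negP => lt.
have ge N : (0 < N)%N -> exists2 r : R, elasticity H R = r%:E &
    (N%:R * l0%:R <= r * (N%:R * k0%:R + C%:R))%R.
  move=> N0; have [c [c' [cC _ Uc]]] := UC N.
  have k_gt0 : (0 < N * k0 + c)%N by rewrite addn_gt0 muln_gt0 N0 k0_gt0.
  have kR : (0 < (N * k0 + c)%:R :> R)%R by rewrite ltr0n.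
  have : ((N * l0 + c')%:R%:E <= elasticity H R * (N * k0 + c)%:R%:E)%E.
    rewrite -lee_pdivrMr //.
    apply: (@le_trans _ _ (rho_k H R (N * k0 + c) * (((N * k0 + c)%:R)^-1)%:E))%E.
      apply: lee_wpmul2r; first by rewrite lee_fin invr_ge0 ltW.
      by apply: ereal_sup_ubound; exists (N * l0 + c')%N.
    by apply: ereal_sup_ubound; exists (N * k0 + c)%N.
  case: (elasticity H R) lt => [r rq h| |]; last 2 first.
  - by [].
  - by rewrite mulNyr gtr0_sg // mul1e.
  exists r => //; move: h; rewrite -EFinM lee_fin => h.
  have r0 : (0 <= r)%R.
    by rewrite -(pmulr_lge0 _ kR); apply: le_trans h; rewrite ler0n.
  apply: le_trans (_ : (N * l0 + c')%:R <= _)%R.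
    by rewrite -natrM ler_nat leq_addr.
  apply: le_trans h _; apply: ler_wpM2l => //.
  by rewrite -natrM -natrD ler_nat leq_add2l.
have [r er _] := ge 1%N isT; move: lt; rewrite er lte_fin ltr_pdivlMr // => lt.
pose N := (Num.truncn (r * C%:R / (l0%:R - r * k0%:R))%R).+1.
have [r' er' h] := ge N isT.
have {er'} rr' : r' = r by move: er'; rewrite er => -[].
rewrite rr' in h.
have : (r * C%:R / (l0%:R - r * k0%:R) < N%:R)%R by exact: truncnS_gt.
rewrite ltr_pdivrMr ?subr_gt0 //; move: h; lra.
Qed.
End Elasticity.

Local Open Scope group_scope.

(** * Commutative cancellative monoids *)

Section CommCancel.
Variable M : ccMonoidType.
Implicit Types x y z : M.

Lemma mulmAC x y z : x * y * z = x * z * y.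
Proof. by rewrite -!mulgA [y * z]mulmC. Qed.

Lemma mulmCA x y z : x * (y * z) = y * (x * z).
Proof. by rewrite !mulgA [x * y]mulmC. Qed.

Lemma mulmACA x y z t : (x * y) * (z * t) = (x * z) * (y * t).
Proof. by rewrite -!mulgA [y * (z * t)]mulmCA. Qed.

Lemma expmMn x y n : (x * y) ^+ n = x ^+ n * y ^+ n.
Proof. by rewrite expgMn //; exact: mulmC. Qed.

Lemma invertible1 : invertible (1 : M).
Proof. by exists 1; rewrite mulg1. Qed.

Lemma invertibleM x y : invertible (x * y) <-> invertible x /\ invertible y.
Proof.
split=> [[z xyz]|[[x' xx'] [y' yy']]].
  by split; [exists (y * z); rewrite mulgA|exists (x * z); rewrite mulmCA mulgA].
by exists (x' * y'); rewrite mulmACA xx' yy' mulg1.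
Qed.

Lemma mulm_eq1r x y : x * y = x -> y = 1.
Proof. by move=> e; apply: (@mulmI _ x); rewrite e mulg1. Qed.
End CommCancel.

(** * The Mori condition and the complete integral closure *)

Section Mori.
Variable H : ccMonoidType.
Let K := cic_monoid H.

Lemma in_cic_inj : injective (@in_cic H).
Proof. by move=> x y /(congr1 val) /inq_inj. Qed.

Lemma conductor_element : conductor H !=set0 ->
  exists f : H, forall x : K, exists h, in_cic h = in_cic f * x.
Proof.
move=> [c Hc]; have [f _ ef] : carrier H c by rewrite -[c]mulg1; apply: Hc; exact: cic1.
exists f => x; have [h _ eh] := Hc _ (valP x); exists h; apply: val_inj.
by rewrite valM /= ef eh.
Qed.

Section Stabilization.
Variable f : H.
Hypothesis fP : forall x : K, exists h, in_cic h = in_cic f * x.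

Let fcic y : y \in @cic H -> carrier H (inq f * y).
Proof.
move=> cy; have [h /(congr1 val)] := fP (exist _ y cy).
by rewrite valM /= => <-; exists h.
Qed.

(* The set [f (q^-k H `&` Hc)]. *)
Let I (q : H) k : set (qgrp H) :=
  [set inq f * y | y in [set y | y \in @cic H /\ carrier H (y * inq q ^+ k)]].

(** Let [x = z / f] for [z] in the closure. By [key], whatever multiplies [q^-k H] within [Hc] into
    [H] also multiplies [x] into [H]. Hence [x] maps the conductor to itself, so all [f x^n] are in
    [H] and [x] is in [Hc]; the choice [a = q^k] gives [x q^k] in [H]. *)
Let I_v_ideal q k : v_ideal (I q k).
Proof.
split=> [_ [y [cy _] <-]|]; first exact: fcic.
apply/seteqP; split=> z; last by move=> Iz y; rewrite mulmC; exact.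
move=> zI; pose x := (inq f)^-1 * z.
have key a : (forall y, y \in @cic H -> carrier H (y * inq q ^+ k) ->
    carrier H (a * y)) -> carrier H (x * a).
  move=> aP; have : colon (carrier H) (I q k) ((inq f)^-1 * a).
    move=> _ [y [cy yq] <-]; rewrite mulmACA mulVg mul1g; exact: aP.
  by move=> /zI; rewrite /x mulgA [z * _]mulmC.
have condM a y : conductor H a -> y \in @cic H -> conductor H (a * y).
  by move=> ca cy b cb; rewrite -mulgA; apply: ca; exact: cicM.
have xcond a : conductor H a -> conductor H (x * a).
  move=> ca y cy; rewrite -mulgA; apply: key => b cb _.
  exact: condM.
have cx : x \in @cic H.
  apply/asboolP; exists f => n _.
  suff : conductor H (inq f * x ^+ n).
    by move=> /(_ 1); rewrite mulg1; apply; exact: cic1.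
  elim: n => [|n IH]; first by rewrite expg0 mulg1; exact: fcic.
  by rewrite expgS mulmCA; exact: xcond.
exists x; last by rewrite /x mulgA mulgV mul1g.
by split=> //; apply: key => y _; rewrite mulmC.
Qed.

(** The v-ideals [I q k] increase with [k], hence become stationary, and [f] cancels in their
    members. *)
Lemma power_stabilizes (q : H) : v_noetherian H ->
  exists k, forall y : K, (exists h, in_cic h = y * in_cic q ^+ k.+1) ->
                          exists h, in_cic h = y * in_cic q ^+ k.
Proof.
move=> /(_ (I q) (I_v_ideal q)) [n z [y [cy [h _ eh]] <-]|k kP].
  exists y => //; split=> //; exists (h * q) => //.
  by rewrite gmulfM /= eh expgSr mulgA.
have valX (y : K) n : val (y * in_cic q ^+ n) = val y * inq q ^+ n.
  by rewrite valM; congr (_ * _); elim: n => [|n IH]; rewrite ?val1 // !expgS valM IH.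
exists k => y [h /(congr1 val)]; rewrite valX /= => eh.
have : I q k.+1 (inq f * val y) by exists (val y) => //; split; [exact: valP|exists h].
rewrite kP // => -[y' [cy' [h' _ eh']]] /mulgI ey.
by exists h'; apply: val_inj; rewrite valX /= eh' ey.
Qed.

(* Apply stability to [y = a^-(k+1)]. *)
Lemma invertible_in_cic (a : H) : v_noetherian H ->
  invertible (in_cic a) -> invertible a.
Proof.
move=> /(power_stabilizes a) [k kP] [b ab].
have [h eh] : exists h, in_cic h = b ^+ k.+1 * in_cic a ^+ k.
  by apply: kP; exists 1; rewrite gmulf1 -expmMn mulmC ab expg1n.
exists h; apply: in_cic_inj; rewrite gmulfM gmulf1 /= eh expgS -mulgA -expmMn.
by rewrite [b * in_cic a]mulmC ab expg1n mulg1.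
Qed.
End Stabilization.
End Mori.

(** * Reduced monoids and free abelian monoids *)

Lemma reduced_eq1 (M : ccMonoidType) (c d : reduced M) : c * d = 1 -> c = 1.
Proof.
have [x ->] := quo_surj c; have [y ->] := quo_surj d.
rewrite -gmulfM => /quo_projP[s [t [_ /asboolP tu e]]].
have /invertibleM[/invertibleM[xu _] _] : invertible (x * y * s) by rewrite e mul1g.
by apply/quo_projP; exists 1, x; split; [apply/asboolP|apply/asboolP|rewrite mulmC];
  first exact: invertible1.
Qed.

Section FreeMonoidTheory.
Variable P : choiceType.
Implicit Types (m : {mset P}) (a : pred P).

Lemma mset_mulE m m' p : (m * m' : {mset P}) p = (m p + m' p)%N.
Proof. by rewrite -[m * m']/(msetD m m') msetE2. Qed.

Lemma mset_expE m n p : (m ^+ n : {mset P}) p = (n * m p)%N.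
Proof.
elim: n => [|n IH]; first by rewrite expg0 mset0E.
by rewrite expgS mset_mulE IH mulSn.
Qed.

Lemma perm_mset_mul m m' : perm_eq (m * m' : {mset P}) ((m : seq P) ++ m').
Proof.
rewrite -(permPr (perm_eq_seq_mset _)); apply/allP => p _ /=.
by rewrite !count_mem_mset mset_mulE mset_seqE count_cat !count_mem_mset.
Qed.

Lemma count_mset_mul a m m' :
  count a (m * m' : {mset P}) = (count a m + count a m')%N.
Proof. by rewrite (permP (perm_mset_mul m m')) count_cat. Qed.

Lemma count_mset1 a : count a (1 : {mset P}) = 0%N.
Proof. by rewrite [X in count a X]enum_mset0. Qed.

Lemma count_mset_exp a m n : count a (m ^+ n : {mset P}) = (n * count a m)%N.
Proof.
elim: n => [|n IH]; first by rewrite expg0 count_mset1.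
by rewrite expgS count_mset_mul IH mulSn.
Qed.

Lemma mset_eq1 m : (count predT m = 0%N) -> m = 1.
Proof.
rewrite count_predT => /size0nil e; apply/msetP => p.
by rewrite -count_mem_mset e mset0E.
Qed.

Lemma mset_mdvd m m' : (forall p, (m p <= m' p)%N) -> mdvd m m'.
Proof.
move=> le; exists (msetB m' m); apply/msetP => p.
by rewrite mset_mulE msetE2 subnKC.
Qed.

End FreeMonoidTheory.

(** * Divisors of elements of the complete integral closure *)

Section DivisorMap.
Variables (H : ccMonoidType) (P : choiceType).
Let K := cic_monoid H.
Variables (psi : {hom K -> (unit_group K * reduced K)})
          (phi : {hom reduced K -> {mset P}}).
Hypothesis psi_bij : bijective psi.
Hypothesis phi_div : divisor_homomorphism phi.

Definition divisor (x : K) : {mset P} := phi (psi x).2.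

Lemma divisorE x : (cic_embed psi phi x).2 = divisor x. Proof. by []. Qed.

Lemma divisor_one : divisor 1 = 1.
Proof. by rewrite -divisorE gmulf1. Qed.

Lemma divisorM x y : divisor (x * y) = divisor x * divisor y.
Proof. by rewrite -!divisorE gmulfM. Qed.

Lemma divisorX x n : divisor (x ^+ n) = divisor x ^+ n.
Proof.
by elim: n => [|n IH]; rewrite ?divisor_one // !expgS divisorM IH.
Qed.

Lemma unit_group_inv (e : unit_group K) : exists e', e * e' = 1.
Proof.
have /asboolP[y ey] := valP e.
have yu : y \in @units K by apply/asboolP; exists (val e); rewrite mulmC.
by exists (exist _ y yu); apply: val_inj; rewrite valM.
Qed.

(** Elements with equal images divide each other, and in a reduced monoid only [1] is invertible. *)
Lemma phi_inj : injective phi.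
Proof.
have dvd a b : phi a = phi b -> mdvd a b.
  by move=> e; apply: phi_div; exists 1; rewrite mulg1 e.
move=> a b e; have [c bc] := dvd _ _ e; have [d ad] := dvd _ _ (esym e).
have : c * d = 1 by apply: (@mulm_eq1r _ a); rewrite mulgA -bc -ad.
by move/reduced_eq1 => c1; rewrite bc c1 mulg1.
Qed.

Lemma cic_embed_inj : injective (cic_embed psi phi).
Proof.
move=> x y [e1 /phi_inj e2]; apply: (bij_inj psi_bij).
by rewrite [LHS]surjective_pairing [RHS]surjective_pairing e1 e2.
Qed.

Lemma embed_inj : injective (embed psi phi).
Proof. by move=> x y /cic_embed_inj /in_cic_inj. Qed.

(** The reduced part of the cofactor comes from [phi_div]; its unit part can be prescribed since
    [psi] is onto. *)
Lemma divisor_dvd x y : mdvd (divisor x) (divisor y) -> mdvd x y.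
Proof.
move=> /phi_div[r er]; have [g psiK gK] := psi_bij.
have [e' ee'] := unit_group_inv (psi x).1.
exists (g (e' * (psi y).1, r)); apply: (bij_inj psi_bij).
rewrite gmulfM gK [LHS]surjective_pairing er; congr (_, _).
by rewrite /= mulgA ee' mul1g.
Qed.

Lemma divisor_eq1 x : divisor x = 1 <-> invertible x.
Proof.
split=> [e|[y xy]].
  have [z xz] : mdvd x 1 by apply: divisor_dvd; exists 1; rewrite e mulg1 divisor_one.
  by exists z.
have : divisor x * divisor y = 1 by rewrite -divisorM xy divisor_one.
move=> /msetP e; apply/msetP => p; have := e p.
by rewrite mset_mulE mset0E => /eqP; rewrite addn_eq0 => /andP[/eqP].
Qed.

Lemma divisor_eq x y : divisor x = divisor y ->
  exists2 u, invertible u & y = x * u.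
Proof.
move=> e; have [u yu] : mdvd x y by apply: divisor_dvd; exists 1; rewrite mulg1 e.
exists u => //; apply/divisor_eq1/(@mulm_eq1r _ (divisor x)).
by rewrite -divisorM -yu.
Qed.

Hypothesis cls : torsion (class_group phi).

(** If the class of [m] has trivial [n]-th power, [m ^+ n] is a quotient of two divisors; as [phi]
    is a divisor homomorphism, it is then itself a divisor. *)
Lemma torsion_divisor (m : {mset P}) :
  exists n a, (0 < n)%N /\ divisor a = m ^+ n.
Proof.
have [n n0 e] := cls (quo_proj _ (inq m)).
have /quo_projP[s [t [/asboolP[a [b es]] /asboolP[c [d et]]]]] :
    quo_proj (principal phi) (inq m ^+ n) = quo_proj _ 1.
  by rewrite gmulfXn e gmulf1.
rewrite -gmulfXn es et mul1g !inq_divE /inq frac_mulE mul1g => /fracP.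
rewrite -mulgA -!gmulfM => em; have [r er] : mdvd (a * d) (c * b).
  by apply: phi_div; exists (m ^+ n); rewrite [RHS]mulmC.
have [g psiK gK] := psi_bij.
exists n, (g (1, r)); split=> //; rewrite /divisor gK /=.
by apply: (@mulmI _ (phi (a * d))); rewrite -gmulfM -er -em [LHS]mulmC.
Qed.
End DivisorMap.

(** * Factorizations into atoms and their lengths *)

Section Factorizations.
Variable H : ccMonoidType.
Implicit Types (a b u : H) (s : seq H).

(* Absorbing a unit [u] makes the description uniform in [a]: [lengths a k] for
   units and nonunits alike, see [lengthsP]. *)
Definition factors_in a k : Prop := exists u s,
  [/\ invertible u, {in s, forall x, atom x}, size s = k & a = u * \prod_(x <- s) x].

Lemma atom_unitM u a : invertible u -> atom a -> atom (u * a).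
Proof.
move=> [u' uu'] [na aP]; split=> [/invertibleM[] //|b c e].
have [] := aP (u' * b) c; first by rewrite -mulgA -e mulgA [u' * u]mulmC uu' mul1g.
  by case/invertibleM; left.
by right.
Qed.

Lemma nonunit_prod s x : {in s, forall y, atom y} -> x \in s ->
  ~ invertible (\prod_(y <- s) y).
Proof.
move=> sP xs; rewrite (big_rem x) //= => /invertibleM[xu _].
by have [] := sP _ xs.
Qed.

Lemma lengthsP a k : lengths a k <-> factors_in a k.
Proof.
split=> [[[au ->]|[na [s [sk sP ->]]]]|[u [s [uu sP <- ->]]]].
- by exists a, [::]; rewrite big_nil mulg1.
- by exists 1, s; rewrite mul1g; split=> //; exact: invertible1.
case: s sP => [|x s] sP; first by left; rewrite big_nil mulg1.
right; split.
  by move=> /invertibleM[_]; apply: (nonunit_prod sP (mem_head x s)).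
exists (u * x :: s); split=> //; last by rewrite !big_cons mulgA.
move=> y; rewrite inE => /orP[/eqP ->|ys]; last by apply: sP; rewrite inE ys orbT.
by apply: atom_unitM => //; apply: sP; exact: mem_head.
Qed.

Lemma factors_inM a b k l :
  factors_in a k -> factors_in b l -> factors_in (a * b) (k + l).
Proof.
move=> [u [s [uu sP <- ->]]] [v [t [vu tP <- ->]]]; exists (u * v), (s ++ t); split.
- by apply/invertibleM.
- by move=> x; rewrite mem_cat => /orP[/sP|/tP].
- by rewrite size_cat.
by rewrite big_cat mulmACA.
Qed.

Lemma factors_in1 : factors_in 1 0.
Proof. by exists 1, [::]; rewrite big_nil mulg1; split=> //; exact: invertible1. Qed.

Lemma factors_in_unit u : invertible u -> factors_in u 0.
Proof. by exists u, [::]; rewrite big_nil mulg1. Qed.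

Lemma factors_in_atom a : atom a -> factors_in a 1.
Proof.
exists 1, [:: a]; rewrite big_seq1 mul1g; split=> //; first exact: invertible1.
by move=> x; rewrite inE => /eqP ->.
Qed.

Lemma factors_inX a k n : factors_in a k -> factors_in (a ^+ n) (n * k).
Proof.
move=> ak; elim: n => [|n IH]; first exact: factors_in1.
by rewrite expgS mulSn; exact: factors_inM.
Qed.

Lemma factors_in_prod (I : Type) (r : seq I) (F : I -> H) (G : I -> nat) :
  (forall i, factors_in (F i) (G i)) ->
  factors_in (\prod_(i <- r) F i) (\sum_(i <- r) G i).
Proof.
move=> FG; elim: r => [|i r IH]; first by rewrite !big_nil; exact: factors_in1.
by rewrite !big_cons; exact: factors_inM.
Qed.

Lemma factors_in_gt0 a k : ~ invertible a -> factors_in a k -> (0 < k)%N.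
Proof.
move=> na [u [[|x s] [uu _ <- e]]] //.
by case: na; rewrite e big_nil mulg1.
Qed.

Lemma unionsP k l : unions H k l <-> exists2 a, factors_in a k & factors_in a l.
Proof.
split=> [[_ [[a _ <-] /lengthsP ak] /lengthsP al]|[a /lengthsP ak /lengthsP al]].
  by exists a.
by exists (lengths a) => //; split=> //; exists a.
Qed.

Lemma unions_sym k l : unions H k l -> unions H l k.
Proof. by move=> /unionsP[a ak al]; apply/unionsP; exists a. Qed.

Lemma unionsD k l k' l' :
  unions H k l -> unions H k' l' -> unions H (k + k') (l + l').
Proof.
move=> /unionsP[a ak al] /unionsP[b bk bl]; apply/unionsP.
by exists (a * b); exact: factors_inM.
Qed.

(** * Gradings by a free abelian monoid that detect units *)

Section Graded.
Variables (P : choiceType) (w : H -> {mset P}).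
Hypothesis w1 : w 1 = 1.
Hypothesis wM : {morph w : a b / a * b}.
Hypothesis w_unit : forall a, w a = 1 <-> invertible a.

Lemma graded_prod (I : Type) (r : seq I) (F : I -> H) p :
  w (\prod_(i <- r) F i) p = (\sum_(i <- r) w (F i) p)%N.
Proof.
elim: r => [|i r IH]; first by rewrite !big_nil w1 mset0E.
by rewrite !big_cons wM mset_mulE IH.
Qed.

Lemma gradedX a n : w (a ^+ n) = w a ^+ n.
Proof. by elim: n => [|n IH]; rewrite ?w1 // !expgS wM IH. Qed.

Lemma nonunit_size a : ~ invertible a -> (0 < size (w a))%N.
Proof.
move=> na; rewrite lt0n; apply/eqP => e; apply: na; apply/w_unit/mset_eq1.
by rewrite count_predT.
Qed.

(** Induction on the degree [size (w a)], which is positive on nonunits and thus drops for both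
    factors of a proper splitting. *)
Lemma factors_in_exists a : exists k, factors_in a k.
Proof.
have [n] := ubnP (size (w a)); elim: n => // n IH in a *.
rewrite ltnS => an; case: (pselect (invertible a)) => [au|na].
  by exists 0%N; exact: factors_in_unit.
case: (pselect (atom a)) => [/factors_in_atom aa|naa]; first by exists 1%N.
suff [b [c [nb nc e]]] : exists b c, [/\ ~ invertible b, ~ invertible c & a = b * c].
  have e' : size (w a) = (size (w b) + size (w c))%N.
    by rewrite -!count_predT e wM count_mset_mul.
  have sb := nonunit_size nb; have sc := nonunit_size nc.
  have [k bk] : exists k, factors_in b k by apply: IH; rewrite e' in an; lia.
  have [l cl] : exists l, factors_in c l by apply: IH; rewrite e' in an; lia.
  by exists (k + l)%N; rewrite e; exact: factors_inM.
apply: contrapT => nex; apply: naa; split=> // b c e; apply: contrapT => nbc.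
by apply: nex; exists b, c; split=> // h; apply: nbc; [left|right].
Qed.

(** Every atom of the factorization uses up a prime of [Q]. All bounds on lengths come from here,
    with [Q] consisting of all primes, of all but one, or of the primes of [E]. *)
Lemma factors_in_le (Q : pred P) a k :
  (forall x y, atom x -> a = x * y -> (0 < count Q (w x))%N) ->
  factors_in a k -> (k <= count Q (w a))%N.
Proof.
move=> aP [u [s [uu sP <- ea]]].
rewrite ea wM count_mset_mul; apply: leq_trans (leq_addl _ _).
have {ea} : exists v, a = v * \prod_(x <- s) x by exists u.
elim: s sP => [|x s IH] sP [v ea] //.
rewrite big_cons wM count_mset_mul /= -add1n; apply: leq_add.
  apply: (aP x (v * \prod_(y <- s) y)); first exact: sP (mem_head _ _).
  by rewrite ea big_cons mulmCA.
apply: IH => [y ys|]; first by apply: sP; rewrite inE ys orbT.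
by exists (v * x); rewrite ea big_cons mulgA.
Qed.

Lemma factors_in_size a k : factors_in a k -> (k <= size (w a))%N.
Proof.
rewrite -count_predT; apply: factors_in_le => x y [nx _] _.
by rewrite count_predT; exact: nonunit_size.
Qed.

Hypothesis nogroup : ~ (forall a, invertible a).

Lemma atom_exists : exists a, atom a.
Proof.
have [a na] : exists a, ~ invertible a.
  by apply: contrapT => h; apply: nogroup => a; apply: contrapT => na; apply: h; exists a.
have [k ak] := factors_in_exists a; have := factors_in_gt0 na ak.
case: ak => u [[|x s] [uu sP <- _]] // _; exists x; exact: sP (mem_head _ _).
Qed.

Lemma unions_refl k : unions H k k.
Proof.
have [a /factors_in_atom /(factors_inX k)] := atom_exists; rewrite muln1 => ak.
by apply/unionsP; exists (a ^+ k).
Qed.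
End Graded.
End Factorizations.

Lemma sum_by_type (T : finType) (A : Type) (r : seq A) (ty : A -> T) (F : T -> nat) :
  (\sum_(x <- r) F (ty x) = \sum_t count (fun x => ty x == t) r * F t)%N.
Proof.
have one x : (\sum_t (ty x == t) * F t = F (ty x))%N.
  rewrite (bigD1 (ty x)) //= eqxx mul1n big1 ?addn0 // => t.
  by rewrite eq_sym => /negbTE ->.
elim: r => [|x r IH]; first by rewrite big_nil big1.
rewrite big_cons IH -one -big_split; apply: eq_bigr => t _.
by rewrite /= -mulnDl.
Qed.

(** * Divisors on [H] and common torsion exponents *)

Section MoriArithmetic.
Variables (H : ccMonoidType) (P : choiceType).
Let K := cic_monoid H.
Variables (psi : {hom K -> (unit_group K * reduced K)})
          (phi : {hom reduced K -> {mset P}}).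
Hypothesis Hmori : v_noetherian H.
Hypothesis nogroup : ~ (forall a : H, invertible a).
Hypothesis psi_bij : bijective psi.
Hypothesis phi_div : divisor_homomorphism phi.
Hypothesis cls : torsion (class_group phi).
Variables (f : H) (fmul : K -> H).
Hypothesis fmulE : forall x : K, in_cic (fmul x) = in_cic f * x.

Local Notation div := (divisor psi phi).
Let w (h : H) : {mset P} := div (in_cic h).

Let w1 : w 1 = 1.
Proof. by rewrite /w gmulf1 divisor_one. Qed.

Let wM : {morph w : a b / a * b}.
Proof. by move=> a b; rewrite /w gmulfM divisorM. Qed.

Let w_unit a : w a = 1 <-> invertible a.
Proof.
split=> [/(divisor_eq1 psi_bij phi_div) |[b ab]].
  apply: (@invertible_in_cic _ f) => // x; by exists (fmul x); exact: fmulE.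
by apply/(divisor_eq1 psi_bij phi_div); exists (in_cic b); rewrite -gmulfM ab gmulf1.
Qed.

Let w_fmul x : w (fmul x) = w f * div x.
Proof. by rewrite /w fmulE divisorM. Qed.

Lemma mori_unions_refl k : unions H k k.
Proof. exact: unions_refl wM w_unit nogroup k. Qed.

Let nonunit_supp h : ~ invertible h -> exists p, (0 < w h p)%N.
Proof.
move=> /(nonunit_size w_unit); case e: (w h : seq P) => [|p s] // _.
by exists p; rewrite -count_mem_mset e /= eqxx.
Qed.

Let uniform_torsion (s : seq P) :
  exists n (a : P -> K), (0 < n)%N /\ forall p, p \in s -> div (a p) = [mset p] ^+ n.
Proof.
suff [n [n0 nP]] : exists n, (0 < n)%N /\
    forall p, exists a, p \in s -> div a = [mset p] ^+ n.
  by have [a aP] := choice nP; exists n, a.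
elim: s => [|q s [n [n0 nP]]]; first by exists 1%N; split=> // p; exists 1.
have [n' [a' [n'0 a'P]]] := torsion_divisor psi_bij phi_div cls [mset q].
exists (n' * n)%N; split=> [|p]; first by rewrite muln_gt0 n'0.
have [->|pq] := eqVneq p q.
  by exists (a' ^+ n) => _; rewrite divisorX a'P expgnA.
have [a aP] := nP p; exists (a ^+ n'); rewrite inE (negbTE pq) /= => /aP ea.
by rewrite divisorX ea mulnC expgnA.
Qed.

(** * The non-simple case *)

Lemma nonsimple_family : ~ simple psi phi ->
  exists B al G, (0 < al)%N /\
    forall N, exists2 c, (c <= G)%N & unions H B (N * al + c).
Proof.
move=> nsimple.
have [A [[h nh Ah] Amin Asing]] : exists A, [/\ essential psi phi A,
    forall B, essential psi phi B -> B `<=` A -> B = A & ~ exists p, A = [set p]].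
  apply: contrapT => nA; apply: nsimple => A Aess Amin; apply: contrapT => As.
  by apply: nA; exists A.
(* A nonunit supported at [p] alone would make this singleton essential, and then equal to [A] by
   minimality. *)
have nprime p x : p \in w h -> ~ invertible x -> (0 < count (predC1 p) (w x))%N.
  move=> ph nx; rewrite lt0n; apply/eqP => c0; apply: Asing; exists p.
  have other q : q != p -> w x q = 0%N.
    move=> qp; apply/eqP; rewrite -leqn0 -count_mem_mset -c0.
    by apply: sub_count => r /= /eqP ->.
  have supp_x : supp (embed psi phi x) = [set p].
    apply/seteqP; split=> [q /= qx|_ ->].
      by apply/eqP/negPn/negP => /other.
    have [q] := nonunit_supp nx; have [->|/other ->] := eqVneq q p => //.
    by rewrite lt0n => /eqP.
  rewrite -supp_x; apply/esym/Amin; first by exists x.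
  rewrite supp_x Ah => _ -> /=; apply/eqP.
  by rewrite mset_neq0.
pose ps : seq P := w h; pose m := size ps.
have m0 : (0 < m)%N by exact: nonunit_size.
have [n [a [n0 aP]]] := uniform_torsion ps.
(* An atom dividing [f a_p^N] contains a prime other than [p], and such primes occur only in [f]. *)
have short N r : {subset r <= ps} -> exists2 k, (k <= size r * size (w f))%N &
    factors_in (\prod_(p <- r) fmul (a p ^+ N)) k.
  elim: r => [|p r IH] rps.
    by exists 0%N => //; rewrite big_nil; exact: factors_in1.
  have [q qr|k kr rk] := IH; first by apply: rps; rewrite inE qr orbT.
  have pps : p \in ps by apply: rps; exact: mem_head.
  have [l pl] := factors_in_exists wM w_unit (fmul (a p ^+ N)).
  exists (l + k)%N; last by rewrite big_cons; exact: factors_inM.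
  rewrite /= mulSn; apply: leq_add => //.
  have lc : (l <= count (predC1 p) (w (fmul (a p ^+ N))))%N.
    by apply: factors_in_le pl => // x y [nx _] _; exact: nprime.
  apply: leq_trans lc _.
  rewrite w_fmul count_mset_mul divisorX aP // -expgnA count_mset_exp.
  have -> : count (predC1 p) [mset p] = 0%N by rewrite enum_msetn /= eqxx.
  by rewrite muln0 addn0 count_size.
have [c0 fc0] := factors_in_exists wM w_unit (f ^+ m.-1).
have [lh hlh] := factors_in_exists wM w_unit h.
have lh0 := factors_in_gt0 nh hlh.
pose B := (m * size (w f))%N.
exists B, (n * lh)%N, (c0 + size (w f) + B)%N; split=> [|N].
  by rewrite muln_gt0 n0.
have [k kB xk] := short N ps (fun _ => id).
have : div (in_cic (f ^+ m * h ^+ (n * N))) =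
       div (in_cic (\prod_(p <- ps) fmul (a p ^+ N))).
  apply/msetP => q; rewrite -!/(w _) wM mset_mulE !(gradedX w1 wM) !mset_expE.
  rewrite (graded_prod w1 wM) (eq_big_seq (fun p => w f q + n * N * [mset p] q)%N).
    rewrite big_split /= big_const_seq count_predT iter_addn_0 -big_distrr /=.
    rewrite mulnC -(count_mem_mset q (w h)) -sum1_count big_mkcond /=.
    congr (_ + _ * _)%N.
    by apply: eq_bigr => p _; rewrite msetnE eq_sym.
  by move=> p pps; rewrite w_fmul mset_mulE divisorX aP // -expgnA mset_expE.
move=> /(divisor_eq psi_bij phi_div)[eta eu e].
(* One factor [f] absorbs the unit [eta] of [Hc], so that the product stays in [H]. *)
have {}e : \prod_(p <- ps) fmul (a p ^+ N) = f ^+ m.-1 * fmul eta * h ^+ (n * N).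
  apply: in_cic_inj; rewrite e !gmulfM /= fmulE mulgA mulmAC; congr (_ * _ * _).
  by rewrite -gmulfM -expgSr prednK.
have [c fc] := factors_in_exists wM w_unit (fmul eta).
have := factors_in_size wM w_unit fc.
rewrite w_fmul (divisor_eq1 psi_bij phi_div eta).2 // mulg1 => cf.
(* Adding [B - k] atoms to both factorizations makes the first length exactly [B] for every [N]. *)
exists (c0 + c + (B - k))%N.
  by rewrite leq_add ?leq_add2l // leq_subr.
have : unions H k (c0 + c + n * N * lh).
  apply/unionsP; exists (\prod_(p <- ps) fmul (a p ^+ N)) => //.
  by rewrite e; apply: factors_inM; [exact: factors_inM|exact: factors_inX].
move=> /unionsD /(_ (mori_unions_refl (B - k))); rewrite subnKC //.
congr (unions _ _ _).
by rewrite addnAC addnC mulnAC [(_ * N)%N]mulnC mulnA.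
Qed.

(** * The simple case: primes of [E] and their exchange *)

Local Notation of_prime := (@of_prime H P).
Local Notation E := (E_set psi phi).

(** The divisor of [h] is a power of [p], and its unit component is cancelled by a unit of [Hc],
    available since [psi] is onto. *)
Let prime_power_in_E h p : ~ invertible h -> supp (embed psi phi h) = [set p] -> E p.
Proof.
move=> nh hp; have others q : q != p -> w h q = 0%N.
  move=> /eqP qp; apply: contrapT => hq; apply: qp.
  by have : supp (embed psi phi h) q by []; rewrite hp.
have hp0 : (0 < w h p)%N.
  have [q] := nonunit_supp nh; have [-> //|/others -> //] := eqVneq q p.
exists (w h p); split=> //.
have [e' ee'] := unit_group_inv (psi (in_cic h)).1.
have [g psiK gK] := psi_bij.
exists h, (g (e', 1)); split.
  by apply/(divisor_eq1 psi_bij phi_div); rewrite /divisor gK gmulf1.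
rewrite /embed /cic_embed gK /= gmulf1.
have opX n : of_prime p ^+ n = (1, [mset p] ^+ n).
  by elim: n => [|n IH] //; rewrite !expgS IH /of_prime; congr (_, _); rewrite mulg1.
rewrite opX; congr (_, _); first by rewrite ee'.
apply/msetP => q; rewrite mset_expE mset_mulE msetnE mset0E addn0 -/(w h q).
by have [->|/others ->] := eqVneq q p; rewrite ?muln1 ?muln0.
Qed.

Let E_power p : E p -> exists h n, (0 < n)%N /\ w h = [mset p] ^+ n.
Proof.
move=> [n [n0 [h [u [uu e]]]]]; exists h, n; split=> //.
have opX : (of_prime p ^+ n).2 = [mset p] ^+ n.
  by elim: n {n0 e} => [|n IH] //; rewrite !expgS -IH.
rewrite -opX e /= -/(w h) -/(div u) (divisor_eq1 psi_bij phi_div u).2 //.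
by rewrite mulg1.
Qed.

Section Simple.
Hypothesis Hsimple : simple psi phi.

(** Among the nonunits with support inside that of [h], one with the fewest primes has a minimal
    essential support, hence a single prime, which lies in [E]. *)
Let nonunit_E h : ~ invertible h -> exists2 p, E p & (0 < w h p)%N.
Proof.
move=> nh; pose d h' := size (undup (w h')).
have ex : exists n, `[< exists2 h', ~ invertible h' &
    {subset w h' <= w h} /\ d h' = n >].
  by exists (d h); apply/asboolP; exists h => //; split.
have [n /asboolP[h' nh' [h'h <-]] dmin] := ex_minnP ex.
have [p Ap] : exists p, supp (embed psi phi h') = [set p].
  apply: Hsimple; first by exists h'.
  move=> _ [h'' nh'' ->] le.
  have sub : {subset w h'' <= w h'}.
    move=> q; rewrite -!mset_neq0 => /eqP /(le q) /eqP hq; exact: hq.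
  have dle : (d h' <= d h'')%N.
    apply: dmin; apply/asboolP; exists h'' => //; split=> // r /sub; exact: h'h.
  have [|_ eqi] := uniq_min_size (undup_uniq (w h'')) _ dle.
    by move=> q; rewrite !mem_undup; exact: sub.
  apply/seteqP; split=> // q /= /eqP; rewrite mset_neq0 -mem_undup -eqi.
  by rewrite mem_undup -mset_neq0 => /eqP.
exists p; first exact: prime_power_in_E Ap.
rewrite mset_gt0; apply: h'h.
by have : supp (embed psi phi h') p by [rewrite Ap]; move/eqP; rewrite mset_neq0.
Qed.

(** A factorization of the new element turns into one of [h] when [q] is exchanged back for [p] in a
    factor containing it, so irreducibility is preserved. *)
Let atom_swap p q y h :
  trace (embed psi phi) (of_prime p) = trace (embed psi phi) (of_prime q) ->
  atom h -> embed psi phi h = of_prime p * y ->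
  exists2 h', atom h' & embed psi phi h' = of_prime q * y.
Proof.
have exch r r' z h0 :
    trace (embed psi phi) (of_prime r) = trace (embed psi phi) (of_prime r') ->
    embed psi phi h0 = of_prime r * z -> exists h', embed psi phi h' = of_prime r' * z.
  move=> e ez; have : trace (embed psi phi) (of_prime r) (inq z).
    split; last by exists z.
    by exists h0 => //=; rewrite ez gmulfM /= mulgA mulVg mul1g.
  rewrite e => -[[h' _ e'] _]; exists h'; apply: inq_inj.
  by rewrite gmulfM /= -e' mulgA mulgV mul1g.
have nonunit r z h0 : embed psi phi h0 = of_prime r * z -> ~ invertible h0.
  move=> e /w_unit /msetP /(_ r); rewrite mset0E.
  have -> : w h0 = [mset r] * z.2 by rewrite /w -divisorE -/(embed psi phi h0) e.
  by rewrite mset_mulE msetnxx.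
move=> e [nh hP] eh; have [h' eh'] := exch _ _ _ _ e eh; exists h'; last exact: eh'.
split=> [|b c ebc]; first exact: nonunit eh'.
have step b' c' : h' = b' * c' -> (0 < w b' q)%N -> invertible c'.
  move=> ebc' bq.
  pose z : ambient H P := ((embed psi phi b').1, msetB (w b') [mset q]).
  have ez : embed psi phi b' = of_prime q * z.
    rewrite [LHS]surjective_pairing; congr (_, _); first by rewrite /= mul1g.
    apply/msetP => r; rewrite mset_mulE msetE2 msetnE -/(w b').
    by case: eqP => [->|_]; rewrite ?subnKC // subn0.
  have [b0 eb0] := exch _ _ _ _ (esym e) ez.
  have : h = b0 * c'.
    apply: (embed_inj psi_bij phi_div); rewrite eh gmulfM /= eb0 -mulgA; congr (_ * _).
    by apply: (@mulmI _ (of_prime q)); rewrite -eh' ebc' gmulfM /= ez -mulgA.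
  by move/hP => [/(nonunit _ _ _ eb0)|].
have : (0 < w h' q)%N.
  have -> : w h' = [mset q] * y.2 by rewrite /w -divisorE -/(embed psi phi h') eh'.
  by rewrite mset_mulE msetnxx.
rewrite ebc wM mset_mulE addn_gt0 => /orP[/(step b c ebc)|/(step c b)]; first by right.
by left; rewrite mulmC in ebc; auto.
Qed.

Hypothesis Hfin :
  finite_set (class_set (embed psi phi) [set of_prime p | p in E]).

Local Notation trace_p p := (trace (embed psi phi) (of_prime p)).

(** One prime of [E] is picked from each of the finitely many classes; [nu] fixes the primes outside
    [E], so that it applies to whole divisors. *)
Let representatives : exists s : seq P, {in s, forall q, E q} /\
  exists nu : P -> P, forall p, [/\ E p -> nu p \in s, ~ E p -> nu p = p &
                                    trace_p p = trace_p (nu p)].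
Proof.
move: Hfin => /finite_seqP[s0 es0].
have s0E X : X \in s0 -> exists2 p, E p & HF_class (embed psi phi) (of_prime p) = X.
  move=> Xs; have : [set` s0] X by [].
  by rewrite -es0 => -[_ [p Ep <-] <-]; exists p.
have [s [sE sP]] : exists s : seq P, {in s, forall q, E q} /\ forall X, X \in s0 ->
    exists2 q, q \in s & HF_class (embed psi phi) (of_prime q) = X.
  elim: s0 s0E {es0} => [|X s0 IH] s0E; first by exists [::].
  have [Y Ys|s [sE sP]] := IH; first by apply: s0E; rewrite inE Ys orbT.
  have [q Eq eq] := s0E X (mem_head _ _).
  exists (q :: s); split=> [r|Y]; rewrite inE => /orP[/eqP ->|] //.
  - exact: sE.
  - by exists q; rewrite ?mem_head.
  - by move=> /sP[r rs er]; exists r => //; rewrite inE rs orbT.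
exists s; split=> //.
suff /choice[nu nuP] : forall p, exists q, [/\ E p -> q \in s, ~ E p -> q = p &
    trace_p p = trace_p q] by exists nu.
move=> p; case: (pselect (E p)) => [Ep|nEp]; last by exists p.
have [|q qs eq] := sP (HF_class (embed psi phi) (of_prime p)).
  have : class_set (embed psi phi) [set of_prime p | p in E]
    (HF_class (embed psi phi) (of_prime p)) by exists (of_prime p) => //; exists p.
  by rewrite es0.
exists q; split; [by []|by move=> /(_ Ep)|].
by have : HF_class (embed psi phi) (of_prime q) (of_prime p) by rewrite eq.
Qed.

(** The primes of [h] are swapped one at a time; in [key], [y] is the part left unchanged. *)
Let atom_normalize nu h : (forall p, trace_p p = trace_p (nu p)) -> atom h ->
  exists2 h', atom h' & w h' = seq_mset (map nu (w h)).
Proof.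
move=> nuP ah.
have prodE (r : seq P) : \prod_(p <- r) of_prime p = (1, seq_mset r) :> ambient H P.
  elim: r => [|p r IH].
    rewrite big_nil; congr (_, _); apply/msetP => q.
    by rewrite mset_seqE mset0E.
  by rewrite big_cons IH mset_cons; congr (_, _); rewrite mulg1.
have key (r : seq P) : forall y h, atom h ->
    embed psi phi h = y * \prod_(p <- r) of_prime p ->
    exists2 h', atom h' & embed psi phi h' = y * \prod_(p <- map nu r) of_prime p.
  elim: r => [|p r IH] y h0 ah0; first by rewrite !big_nil; exists h0.
  rewrite big_cons mulgA => /(IH _ _ ah0)[h1 ah1].
  rewrite -mulgA mulmCA => e1.
  have [h2 ah2 e2] := atom_swap (nuP p) ah1 e1.
  by exists h2 => //; rewrite /= big_cons e2 mulmCA.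
have [|h' ah' e] := key (w h) ((embed psi phi h).1, 1) h ah.
  rewrite prodE seq_mset_id [LHS]surjective_pairing; congr (_, _).
    by rewrite /= mulg1.
  by rewrite /= mul1g.
exists h' => //; rewrite /w -divisorE -/(embed psi phi h') e prodE.
by rewrite /= mul1g.
Qed.

(** Some [g] in [H] has divisor [p^n]; let [k] be its exponent of stability. If [p] had exponent
    above [n (k + 2)] in an atom [h], then [h = y g^(k+2)] with [y] in [Hc], and stability would put
    [h / g] into [H], a nonunit since [p] still occurs in it. *)
Let atom_bounded (s : seq P) : {in s, forall q, E q} ->
  exists C, forall h, atom h -> {in s, forall q, (w h q <= C)%N}.
Proof.
elim: s => [|p s IH] sE; first by exists 0%N.
have [q qs|C CP] := IH; first by apply: sE; rewrite inE qs orbT.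
have [g [n [n0 wg]]] := E_power (sE p (mem_head _ _)).
have [k kP] : exists k, forall y : K, (exists h, in_cic h = y * in_cic g ^+ k.+1) ->
    exists h, in_cic h = y * in_cic g ^+ k.
  by apply: power_stabilizes Hmori => x; exists (fmul x).
have gp : w g p = n by rewrite wg mset_expE msetnxx muln1.
have wp_nonunit h : (0 < w h p)%N -> ~ invertible h.
  by move=> hp /w_unit e; rewrite e mset0E in hp.
exists (maxn C (n * k.+2)) => h ah q; rewrite inE => /orP[/eqP ->|/(CP _ ah) qC];
  last by rewrite leq_max qC.
rewrite leq_max; apply/orP; right; rewrite leqNgt; apply/negP => lt.
have [y ey] : mdvd (in_cic g ^+ k.+2) (in_cic h).
  apply: (divisor_dvd psi_bij phi_div); rewrite divisorX -/(w g) -/(w h) wg -expgnA.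
  apply: mset_mdvd => r; rewrite mset_expE msetnE.
  by case: eqP => [->|_]; rewrite ?muln1 ?muln0 // ltnW.
have [h1 eh1] : exists h1, in_cic h1 = (y * in_cic g) * in_cic g ^+ k.
  by apply: kP; exists h; rewrite ey mulmC -mulgA -expgS.
have eh : h = g * h1.
  apply: in_cic_inj.
  rewrite gmulfM /= eh1 ey !expgS -!mulgA [_ * y]mulmC; congr (_ * _).
  exact: mulmCA.
have [_ /(_ _ _ eh)] := ah; case; apply: wp_nonunit; first by rewrite gp.
have : w h p = (n + w h1 p)%N by rewrite eh wM mset_mulE gp.
by move: lt; rewrite mulnS; lia.
Qed.

(** * The extremal family in the simple case *)

Lemma simple_family : exists k0 l0 C, [/\ (0 < k0)%N, (k0 <= l0)%N,
  forall N, exists c c', [/\ (c <= C)%N, (c' <= C)%N &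
                            unions H (N * k0 + c) (N * l0 + c')] &
  forall k l, unions H k l -> (l * k0 <= k * l0)%N].
Proof.
have [s [sE [nu nuP]]] := representatives.
have nu_trace p : trace_p p = trace_p (nu p) by have [] := nuP p.
have nuE p : E p -> nu p \in s by have [] := nuP p.
have nu_id p : ~ E p -> nu p = p by have [] := nuP p.
have [C CP] := atom_bounded sE.
pose rep (i : 'I_(size s)) := tnth (in_tuple s) i.
have reps i : rep i \in s by exact: mem_tnth.
have repE q : q \in s -> exists i, q = rep i by move=> /(tnthP (in_tuple s)).
pose tau h (i : 'I_(size s)) := count (fun p => nu p == rep i) (w h).
have tauM a b i : tau (a * b) i = (tau a i + tau b i)%N.
  by rewrite /tau wM count_mset_mul.
have tau_unit u i : invertible u -> tau u i = 0%N.
  by move=> /w_unit e; rewrite /tau e count_mset1.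
have tau_prod (r : seq H) i : tau (\prod_(x <- r) x) i = (\sum_(x <- r) tau x i)%N.
  elim: r => [|x r IH]; first by rewrite !big_nil tau_unit //; exact: invertible1.
  by rewrite !big_cons tauM IH.
have norm h : atom h -> exists2 h', atom h' &
    forall p, w h' p = count (fun q => nu q == p) (w h).
  move=> /(atom_normalize nu_trace)[h' ah' eh']; exists h' => // p.
  by rewrite eh' mset_seqE count_map.
have tauC h i : atom h -> (tau h i <= C)%N.
  by move=> /norm[h' ah' eh']; rewrite /tau -eh'; exact: CP.
have tau_gt0 h : ~ invertible h -> exists i, (0 < tau h i)%N.
  move=> /nonunit_E[p Ep hp]; have [i ei] := repE _ (nuE _ Ep); exists i.
  rewrite -has_count; apply/hasP; exists p; last by rewrite ei.
  by rewrite -mset_neq0 -lt0n.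
(* By [tauC] the entries of [tau] are at most [C] on atoms, where [inord] is therefore faithful;
   this leaves finitely many types. *)
pose T : finType := {ffun 'I_(size s) -> 'I_C.+1}.
pose ty h : T := [ffun i => inord (tau h i)].
have tyE h i : atom h -> (ty h i : nat) = tau h i.
  by move=> ah; rewrite ffunE inordK // ltnS; exact: tauC.
(* [c (true, t)] and [c (false, t)] count the atoms of type [t] on the two sides
   of an equation between products of atoms, up to the components outside [E]. *)
pose S : set (bool * T -> nat) := [set c |
  (forall b t, (0 < c (b, t))%N -> exists2 h, atom h & ty h = t) /\
  forall i, (\sum_t c (true, t) * t i = \sum_t c (false, t) * t i)%N].
pose len b (c : bool * T -> nat) := (\sum_t c (b, t))%N.
have lenB b c c' : (forall x, c x <= c' x)%N ->
    (len b c + len b (fun x => c' x - c x) = len b c')%N.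
  by move=> le; rewrite /len -big_split; apply: eq_bigr => t _; rewrite /= subnKC.
have lists (xs ys : seq H) : {in xs, forall x, atom x} -> {in ys, forall x, atom x} ->
    (forall i, tau (\prod_(x <- xs) x) i = tau (\prod_(x <- ys) x) i) ->
    exists2 c, S c & len true c = size ys /\ len false c = size xs.
  move=> xsP ysP e.
  exists (fun x => count (fun y => ty y == x.2) (if x.1 then ys else xs)); last first.
    have sz (zs : seq H) : (\sum_(t : T) count (fun y => ty y == t) zs = size zs)%N.
      rewrite -sum1_size (sum_by_type zs ty (fun=> 1%N)).
      by apply: eq_bigr => t _; rewrite muln1.
    by split; rewrite /len /= sz.
  split=> [b t|i] /=.
    rewrite -has_count => /hasP[x xin /eqP <-]; exists x => //.
    by case: b xin => [/ysP|/xsP].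
  have tz (zs : seq H) : {in zs, forall x, atom x} ->
      (\sum_(t : T) count (fun y => ty y == t) zs * t i = tau (\prod_(x <- zs) x)%g i)%N.
    move=> zsP; rewrite -(sum_by_type zs ty (fun t => t i : nat)) tau_prod.
    by apply: eq_big_seq => x /zsP; exact: tyE.
  by rewrite !tz // e.
have [h0 ah0] := atom_exists wM w_unit nogroup.
have [c1 Sc1 [lt1 lf1]] : exists2 c, S c & len true c = 1%N /\ len false c = 1%N.
  have h0P : {in [:: h0], forall x, atom x} by move=> x; rewrite inE => /eqP ->.
  exact: (lists _ _ h0P h0P (fun=> erefl)).
have [c [Sc c_gt0 cmax]] : exists c, [/\ S c, (0 < len false c)%N &
    forall c', S c' -> (len true c' * len false c <= len true c * len false c')%N].
  apply: ratio_attained (lenB true) (lenB false) _ _.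
  - move=> a b [Sa ea] [Sb eb] le; split=> [x t|i].
      by move=> lt; apply: (Sb x); apply: leq_trans lt (leq_subr _ _).
    have dist x : (\sum_t (b (x, t) - a (x, t)) * t i =
        \sum_t b (x, t) * t i - \sum_t a (x, t) * t i)%N.
      rewrite -sumnB; last by move=> t _; rewrite leq_mul2r le orbT.
      by apply: eq_bigr => t _; rewrite mulnBl.
    by rewrite !dist ea eb.
  (* Every atom contains a prime of [E], so if the [false] side is empty, so is the [true] side. *)
  - move=> a [Sa ea] /eqP; rewrite sum_nat_eq0 => /forallP a0; apply/eqP.
    rewrite sum_nat_eq0; apply/forallP => t; apply/implyP => _.
    rewrite -leqn0 leqNgt; apply/negP => /[dup] at0 /Sa[h ah eh].
    have [i ti] := tau_gt0 h ah.1; rewrite -tyE // eh in ti.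
    have := ea i; rewrite [RHS]big1 => [|t' _]; last by rewrite (eqP (a0 t')).
    move/eqP; rewrite sum_nat_eq0 => /forallP/(_ t) /=.
    by rewrite muln_eq0 !gtn_eqF.
  - by exists c1; rewrite ?lf1.
(* The exponent at a prime [p] of [E] in a normalized atom of type [t], zero if [p] is no
   representative. *)
pose g (t : T) p : nat := if [pick i | rep i == p] is Some i then t i else 0%N.
have /choice[al alP] : forall t, exists a, (exists2 h, atom h & ty h = t) ->
    atom a /\ forall p, E p -> w a p = g t p.
  move=> t.
  case: (pselect (exists2 h, atom h & ty h = t)) => [[h ah <-]|nt]; last by exists 1.
  have [h' ah' eh'] := norm _ ah; exists h' => _; split=> // p Ep.
  rewrite eh' /g; case: pickP => [i /eqP <-|none]; first by rewrite tyE.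
  apply/eqP; rewrite -leqn0 leqNgt -has_count; apply/hasPn => q _.
  apply/eqP => eq; case: (pselect (E q)) => [/nuE /repE[i ei]|nEq].
    by have := none i; rewrite -ei eq eqxx.
  by apply: (nEq); rewrite -(nu_id _ nEq) eq.
pose A b := \prod_(t : T) al t ^+ c (b, t).
have A_len b : factors_in (A b) (len b c).
  apply: factors_in_prod => t; case: (posnP (c (b, t))) => [->|ct].
    exact: factors_in1.
  rewrite -[X in factors_in _ X]muln1.
  by apply/factors_inX/factors_in_atom/(alP t _).1/(Sc.1 b).
have A_w b p : E p -> w (A b) p = (\sum_t c (b, t) * g t p)%N.
  move=> Ep; rewrite (graded_prod w1 wM); apply: eq_bigr => t _.
  rewrite (gradedX w1 wM) mset_expE; case: (posnP (c (b, t))) => [->|ct] //.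
  by rewrite (alP t _).2 //; exact: (Sc.1 b).
have A_E p : E p -> w (A true) p = w (A false) p.
  move=> Ep; rewrite !A_w // /g; case: pickP => [i _|_]; first exact: Sc.2.
  by rewrite !big1 // => t _; rewrite muln0.
(* The two products differ only outside [E]. The primes that one side lacks form, after raising to a
   power, the divisor of a correction factor [a1] or [a2]. *)
have [n1 [a1 [n1_gt0 a1P]]] :=
  torsion_divisor psi_bij phi_div cls (msetB (w (A false)) (w (A true))).
have [n2 [a2 [n2_gt0 a2P]]] :=
  torsion_divisor psi_bij phi_div cls (msetB (w (A true)) (w (A false))).
pose n := (n1 * n2)%N; have n_gt0 : (0 < n)%N by rewrite muln_gt0 n1_gt0.
pose Q : pred P := fun p => `[< E p >].
have Q0 (m : {mset P}) : (forall p, E p -> m p = 0%N) -> count Q m = 0%N.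
  move=> m0; apply/eqP; rewrite -leqn0 leqNgt -has_count; apply/hasPn => p.
  by rewrite -mset_neq0; apply: contra => /asboolP /m0 ->.
(* Every atom contains a prime of [E]; in [f x2] and [f x1 eta] below only [f] contributes such
   primes, so the bound is independent of [N]. *)
have short h : exists2 k, (k <= count Q (w h))%N & factors_in h k.
  have [k hk] := factors_in_exists wM w_unit h; exists k => //.
  apply: (factors_in_le wM _ hk) => x y [nx _] _.
  have [p Ep xp] := nonunit_E nx; rewrite -has_count; apply/hasP; exists p.
    by rewrite -mset_neq0 -lt0n.
  exact/asboolP.
exists (n * len false c)%N, (n * len true c)%N, (count Q (w f)); split.
- by rewrite muln_gt0 n_gt0.
- by have := cmax _ Sc1; rewrite lt1 lf1 mul1n muln1 leq_pmul2l.
- move=> N; pose x1 := a1 ^+ (n2 * N); pose x2 := a2 ^+ (n1 * N).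
  have dx1 : div x1 = msetB (w (A false)) (w (A true)) ^+ (n * N).
    by rewrite divisorX a1P -expgnA mulnA.
  have dx2 : div x2 = msetB (w (A true)) (w (A false)) ^+ (n * N).
    by rewrite divisorX a2P -expgnA mulnA [(n2 * n1)%N]mulnC.
  have : div (in_cic (A true ^+ (n * N) * fmul x1)) =
         div (in_cic (A false ^+ (n * N) * fmul x2)).
    apply/msetP => p; rewrite -!/(w _) !wM !mset_mulE !(gradedX w1 wM) !w_fmul !mset_mulE.
    rewrite dx1 dx2 !mset_expE !msetE2.
    have : (w (A true) p + (w (A false) p - w (A true) p) =
            w (A false) p + (w (A true) p - w (A false) p))%N by lia.
    move: (w f p) (_ - _)%N (_ - _)%N => y z t.
    by rewrite addnCA -mulnDr => ->; rewrite mulnDr; lia.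
  move=> /(divisor_eq psi_bij phi_div)[eta eu e].
  have {}e : A false ^+ (n * N) * fmul x2 = A true ^+ (n * N) * fmul (x1 * eta).
    by apply: in_cic_inj; rewrite e !gmulfM /= !fmulE !mulgA.
  have [c' c'Q fc'] := short (fmul x2); have [c'' c''Q fc''] := short (fmul (x1 * eta)).
  exists c', c''; split.
  + apply: leq_trans c'Q _; rewrite w_fmul count_mset_mul [X in (_ + X)%N]Q0 ?addn0 //.
    by move=> p Ep; rewrite dx2 mset_expE msetE2 A_E // subnn muln0.
  + apply: leq_trans c''Q _; rewrite w_fmul divisorM count_mset_mul.
    rewrite (divisor_eq1 psi_bij phi_div eta).2 // mulg1 [X in (_ + X)%N]Q0 ?addn0 //.
    by move=> p Ep; rewrite dx1 mset_expE msetE2 A_E // subnn muln0.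
  apply/unionsP; exists (A false ^+ (n * N) * fmul x2).
    by apply: factors_inM => //; rewrite mulnA [(N * n)%N]mulnC; exact: factors_inX.
  rewrite e; apply: factors_inM => //.
  by rewrite mulnA [(N * n)%N]mulnC; exact: factors_inX.
move=> k l /unionsP[a [u [xs [uu xsP sx ea]]] [v [ys [vu ysP sy eb]]]].
have [i|c' Sc' [lt lf]] := lists _ _ xsP ysP.
  have := tauM u (\prod_(x <- xs) x) i; rewrite -ea eb tauM.
  by rewrite (tau_unit u) // (tau_unit v) // !add0n.
rewrite mulnCA [(k * _)%N]mulnCA leq_pmul2l // [(k * _)%N]mulnC -sx -sy -lt -lf.
exact: cmax.
Qed.
End Simple.
End MoriArithmetic.

(** * Unions of sets of lengths and elasticity in the two cases *)

Theorem theorem1p1 (R : realType) (H : ccMonoidType) (P : choiceType)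
    (psi : {hom cic_monoid H ->
              (unit_group (cic_monoid H) * reduced (cic_monoid H))})
    (phi : {hom reduced (cic_monoid H) -> {mset P}}) :
  v_noetherian H ->
  ~ (forall a : H, invertible a) ->
  conductor H !=set0 ->
  bijective psi ->
  divisor_theory phi ->
  torsion (class_group phi) ->
  (~ simple psi phi ->
     (exists k0, forall k, (0 < k)%N -> (k0 <= k)%N -> rho_k H R k = +oo%E) /\
     structure_theorem_for_unions H) /\
  (simple psi phi ->
     finite_set (class_set (embed psi phi) [set of_prime H p | p in E_set psi phi]) ->
     (exists q : rat, elasticity H R = (ratr q)%:E%E) /\
     structure_theorem_for_unions H).
Proof.
move=> Hmori nogroup cond psi_bij [phi_div _] cls.
have [f /choice[fmul fmulE]] := conductor_element cond.
have Urefl := mori_unions_refl Hmori nogroup psi_bij phi_div fmulE.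
split=> [nsimple|Hsimple Hfin].
  have [B [al [G [al0 UB]]]] :=
    nonsimple_family Hmori nogroup psi_bij phi_div cls fmulE nsimple.
  split; last first.
    exact: structure_unbounded Urefl (@unions_sym H) (@unionsD H) _ _ _ al0 UB.
  exists B => k _ Bk; apply: rho_infty => x.
  exact: union_unbounded Urefl (@unionsD H) _ _ _ al0 UB _ x Bk.
have [k0 [l0 [C [k0_gt0 kl0 UC Ule]]]] :=
  simple_family Hmori nogroup psi_bij phi_div cls fmulE Hsimple Hfin.
split; first by exists (l0%:Q / k0%:Q)%R; exact: elasticity_eq k0_gt0 UC Ule.
exact: structure_bounded Urefl (@unions_sym H) (@unionsD H) _ _ _ k0_gt0 kl0 UC Ule.
Qed.
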